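(* There exist a nontrivial i.i.d. measure $\mu$ on $[0,\infty)^{\mathrm{Edges}(\mathbb{Z}^2)}$ and points $x_1,\dots,x_8\in\mathbb{Z}^2$ such that $$\mathbf{P}\big(C(x_1,\dots,x_8)\big)>0 .$$
   Context: $\mathrm{Edges}(\mathbb{Z}^2)$ is the set of nearest-neighbour edges of $\mathbb{Z}^2$. An i.i.d. measure is a product probability measure on $[0,\infty)^{\mathrm{Edges}(\mathbb{Z}^2)}$ with identical marginals; nontrivial means that the common marginal is not a point mass. $\omega$ is a realization of $\mu$ and $\mathbf{P}$ the corresponding probability. For $x,y\in\mathbb{Z}^2$ the passage time is $\tau(x,y)=\inf\sum\omega(v_i,v_{i+1})$, where the sum is over the edges of a nearest-neighbour path and the infimum is over all finite paths from $x$ to $y$. Growth model: for $x_1,\dots,x_k\in\mathbb{Z}^2$, $z\in\mathbb{Z}^2$ and $t\ge0$ put $\tilde\omega_{x_1,\dots,x_k}(z,t)=i$ if $\tau(x_i,z)\le t$ and $\tau(x_i,z)<\tau(x_j,z)$ for all $j\ne i$, and $\tilde\omega_{x_1,\dots,x_k}(z,t)=0$ if there is no such $i$. Let $\tilde\omega_{x_1,\dots,x_k}(z)=\lim_{t\to\infty}\tilde\omega_{x_1,\dots,x_k}(z,t)$. Coexistence $C(x_1,\dots,x_k)$ is the event that for every $i\in\{1,\dots,k\}$ the set $\{z\in\mathbb{Z}^2:\tilde\omega_{x_1,\dots,x_k}(z)=i\}$ is infinite. *)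

(* Defs.v *)
From HB Require Import structures.
From mathcomp Require Import all_boot all_order all_algebra.
From mathcomp Require Import all_classical all_reals all_analysis.
From mathcomp Require Import zify.

Set Implicit Arguments.
Unset Strict Implicit.
Unset Printing Implicit Defensive.

Import Order.TTheory GRing.Theory Num.Theory.
Import numFieldNormedType.Exports.

Local Open Scope classical_set_scope.
Local Open Scope ring_scope.

Definition Z2 : Type := (int * int)%type.

Definition neighbour : rel Z2 :=
  fun u v => `|u.1 - v.1| + `|u.2 - v.2| == 1 :> int.

(** An undirected edge is coded by its lower-left endpoint and a boolean:
    [((a, b), false)] joins (a, b) to (a + 1, b) and [((a, b), true)] joins
    (a, b) to (a, b + 1). *)
Definition edge : Type := (Z2 * bool)%type.

Definition edge_src (e : edge) : Z2 := e.1.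
Definition edge_tgt (e : edge) : Z2 :=
  if e.2 then (e.1.1, e.1.2 + 1) else (e.1.1 + 1, e.1.2).

(** The edge {u, v}; meaningful only when [neighbour u v]. *)
Definition edge_of (u v : Z2) : edge :=
  if u.2 == v.2 then ((Num.min u.1 v.1, u.2), false)
  else ((u.1, Num.min u.2 v.2), true).

(** [edge_of] induces a bijection from unordered pairs of neighbours
    onto [edge]. *)
Lemma neighbour_edge (e : edge) : neighbour (edge_src e) (edge_tgt e).
Proof. by case: e => [[a b] []]; rewrite /neighbour/=; lia. Qed.

Lemma edge_of_ends (e : edge) : edge_of (edge_src e) (edge_tgt e) = e.
Proof.
case: e => [[a b] []]; rewrite /edge_of/=.
- have -> : (b == b + 1) = false by lia.
  by congr (_, _, _); lia.
- by rewrite eqxx; congr (_, _, _); lia.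
Qed.

Lemma ends_edge_of (u v : Z2) : neighbour u v ->
  (edge_src (edge_of u v), edge_tgt (edge_of u v)) = (u, v) \/
  (edge_src (edge_of u v), edge_tgt (edge_of u v)) = (v, u).
Proof.
case: u v => [a b] [c d]; rewrite /neighbour /edge_of/= => h.
case: eqP => bd; rewrite /edge_src /edge_tgt /=.
- subst d; have [ac|ac] := leP a c.
  + by left; congr (_, _, (_, _)); lia.
  + by right; congr (_, _, (_, _)); lia.
- have ac : a = c by lia.
  subst c; have [bd'|bd'] := leP b d.
  + by left; congr (_, _, (_, _)); lia.
  + by right; congr (_, _, (_, _)); lia.
Qed.

Lemma edge_ofC (u v : Z2) : neighbour u v -> edge_of u v = edge_of v u.
Proof.
case: u v => [a b] [c d]; rewrite /neighbour /edge_of/= => h.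
rewrite (eq_sym d b); case: eqP => bd.
- by congr (_, _, _); lia.
- by congr (_, _, _); lia.
Qed.

Section Configurations.
Variable R : realType.

(** The sample space: [0, oo)^edge with the product of the Borel
    sigma-algebras. *)
Definition weights : Type := edge -> {nonneg R}.

HB.instance Definition _ := gen_eqMixin weights.
HB.instance Definition _ := gen_choiceMixin weights.
HB.instance Definition _ := isPointed.Build weights (fun=> 0%:nng).

Definition weight (e : edge) (w : weights) : R := (w e)%:num.

Definition cylinders : set (set weights) :=
  [set C | exists e (B : set R), measurable B /\ C = weight e @^-1` B].

Definition config := g_sigma_algebraType cylinders.

Definition marginal (mu : probability config R) (e : edge) :
  set R -> \bar R := pushforward mu (weight e).

Definition product_measure_law (mu : probability config R) : Prop :=
  forall (s : seq edge) (B : edge -> set R),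
    uniq s -> (forall e, measurable (B e)) ->
    mu [set w | forall e, e \in s -> B e (weight e w)] =
    (\prod_(e <- s) marginal mu e (B e))%E.

Definition identical_marginals (mu : probability config R) : Prop :=
  forall (e e' : edge) (B : set R),
    measurable B -> marginal mu e B = marginal mu e' B.

Definition iid (mu : probability config R) : Prop :=
  product_measure_law mu /\ identical_marginals mu.

Definition point_mass (nu : set R -> \bar R) : Prop :=
  exists a : R, forall B : set R, measurable B -> nu B = \d_a B.

Definition nontrivial (mu : probability config R) : Prop :=
  forall e : edge, ~ point_mass (marginal mu e).

End Configurations.

Section Growth.
Variable R : realType.
Implicit Type w : config R.

(** The path visits x and then, in order, the vertices of p. *)
Definition path_time w (x : Z2) (p : seq Z2) : R :=
  \sum_(e <- pairmap edge_of x p) weight e w.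

Definition passage_time w (x y : Z2) : R :=
  inf [set path_time w x p | p in
        [set p : seq Z2 | path neighbour x p /\ last x p = y]].

(** The points are indexed from 0: the label of [x i] is [i.+1], and the
    label 0 means that no point has reached z strictly first by time t. *)
Definition label_at w k (x : 'I_k -> Z2) (z : Z2) (t : R) : nat :=
  if [pick i : 'I_k | (passage_time w (x i) z <= t) &&
        [forall j : 'I_k, (j != i) ==>
          (passage_time w (x i) z < passage_time w (x j) z)]]
  is Some i then i.+1 else 0%N.

Definition label w k (x : 'I_k -> Z2) (z : Z2) : nat :=
  lim (label_at w x z t @[t --> +oo]).

Definition coexistence k (x : 'I_k -> Z2) : set (config R) :=
  [set w | forall i : 'I_k, infinite_set [set z : Z2 | label w x z = i.+1]].

End Growth.

(* Main.v *)
From HB Require Import structures.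
Require Import Defs.
From mathcomp Require Import all_boot all_order all_algebra.
From mathcomp Require Import all_classical all_reals all_analysis.
From mathcomp Require Import measurable_realfun zify ring lra.

(** The edges get independent weights 1 and 2, the value 2 with probability
    [p = 1/1000].  Passage times are then natural numbers which depend on
    finitely many edges.  Write [tau] for the passage time and let [nu v] be the
    infimum over [m > 0] of [E tau(0, m v) / m].

    The heart of the proof is a criterion, [wins_likely].  If
    [E tau(0, v + q) < 2 nu(v)], then, for [N] large, there are infinitely many
    [n] such that, with probability close to 1, the site [z = n v] is closer to
    [N v] than to [N q].  Indeed
    [tau(N q, z) >= tau(- N v, z) - tau(- N v, N q)].  The last term is at most a
    sum of [N] hops, each distributed as [tau(0, v + q)].  The difference
    [tau(- N v, z) - tau(N v, z)] is at most a sum of hops from [- N v] to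
    [N v], whose mean is close to [2 N nu(v)]; and its own mean telescopes in
    [n], so that it is nearly as large for infinitely many [n].  A variable whose
    mean is close to an upper bound is close to that bound with high
    probability, by Markov's inequality.  Distant hops depend on disjoint sets
    of edges, hence sums of hops obey Chebyshev's inequality
    ([hops_deviation]).

    The criterion is applied to the eight points [(+-M, 0)], [(0, +-M)] and
    [(+-N, +-N)], with [N = 10^4] and [M = 2 N - 1].  It needs a lower bound of
    [nu] at these points and an upper bound of [E tau(0, v + q)] for any two of
    them.
    - On the diagonals [nu(N, N) >= 2 N], because every edge costs at least 1.
    - On the axes [nu(M, 0) >= (1 + 1/26000) M] ([polymer_speed]): a path which
      goes to the right has to avoid the edges of weight 2 by costly vertical
      moves, and a first moment bound shows that too few paths do so.
    - For the sums the critical one is [(M + N, N)], which is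
      [(N - 1) (3, 1) + (2, 1)]: two edge-disjoint monotone paths from 0 to
      [(a, 1)] give [E tau(0, (a, 1)) <= a + 1 + ((a + 1) p)^2]
      ([Ed_two_paths]).
    In other words a loss of order [p^2] near the diagonals is smaller than the
    loss along the axes, of order [p / log (1 / p)], so that the norm [nu] is
    not a multiple of the l1 norm.

    Each of the eight points is thus ahead at infinitely many sites with
    probability at least 15/16 ([often_ahead]), and all of them are with
    probability at least 1/2.  The weights are read off the digits, with unequal
    branches, of a uniform point of the unit interval. *)

Set Implicit Arguments.
Unset Strict Implicit.
Unset Printing Implicit Defensive.

Import Order.TTheory GRing.Theory Num.Theory.
Import numFieldNormedType.Exports.
Local Open Scope ring_scope.

(** * Finitary functions of independent coins *)

Section Dependence.
Variable I : eqType.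
Implicit Types (A B : pred I) (b : I -> bool).

(** [f] depends only on the coordinates in [A]. *)
Definition depends_on (T : Type) A (f : (I -> bool) -> T) : Prop :=
  forall b b', (forall e, A e -> b e = b' e) -> f b = f b'.

(** [f] depends only on finitely many coordinates. *)
Definition finitary (T : Type) (f : (I -> bool) -> T) : Prop :=
  exists s : seq I, depends_on (mem s) f.

Lemma depends_on_sub T A B (f : (I -> bool) -> T) :
  (forall e, A e -> B e) -> depends_on A f -> depends_on B f.
Proof. by move=> AB fA b b' bb'; apply: fA => e /AB /bb'. Qed.

Lemma depends_on_comp2 T U V A (F : T -> U -> V) f g :
  depends_on A f -> depends_on A g -> depends_on A (fun b => F (f b) (g b)).
Proof. by move=> fA gA b b' bb'; rewrite (fA _ _ bb') (gA _ _ bb'). Qed.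

Lemma finitary_pair T U (f : (I -> bool) -> T) (g : (I -> bool) -> U) :
  finitary f -> finitary g ->
  exists s : seq I, depends_on (mem s) f /\ depends_on (mem s) g.
Proof.
move=> [s fs] [t gt]; exists (s ++ t); split.
- by apply: depends_on_sub fs => e /= es; rewrite mem_cat es.
- by apply: depends_on_sub gt => e /= et; rewrite mem_cat et orbT.
Qed.

Lemma finitary_comp2 T U V (F : T -> U -> V) f g :
  finitary f -> finitary g -> finitary (fun b => F (f b) (g b)).
Proof.
move=> ff fg; have [s [fs gs]] := finitary_pair ff fg.
by exists s; exact: depends_on_comp2.
Qed.

Lemma finitary_comp T U (F : T -> U) f :
  finitary f -> finitary (fun b => F (f b)).
Proof. by move=> [s fs]; exists s => b b' bb'; rewrite (fs _ _ bb'). Qed.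

Lemma finitary_cst T (c : T) : finitary (fun=> c).
Proof. by exists [::]. Qed.

Lemma finitary_coord e : finitary (fun b => b e).
Proof. by exists [:: e] => b b' -> //; rewrite /= inE. Qed.

Lemma finitary_big T (idx : T) (op : T -> T -> T) (J : Type) (r : seq J)
    (F : J -> (I -> bool) -> T) :
  (forall j, finitary (F j)) ->
  finitary (fun b => \big[op/idx]_(j <- r) F j b).
Proof.
move=> FF; elim: r => [|j r IH].
  under eq_fun do rewrite big_nil.
  exact: finitary_cst.
under eq_fun do rewrite big_cons.
exact: finitary_comp2.
Qed.

(** The part of a finite set of coordinates outside [A] is irrelevant for a
    function which depends only on [A]. *)
Lemma depends_on_filter T A (s : seq I) (f : (I -> bool) -> T) :
  depends_on A f -> depends_on (mem s) f -> depends_on (mem (seq.filter A s)) f.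
Proof.
move=> fA fs b b' bb'.
rewrite (fA b (fun e => if A e then b e else b' e)); last by move=> e ->.
by apply: fs => e /= es; case: ifP => // Ae; apply: bb'; rewrite /= mem_filter Ae.
Qed.

End Dependence.

Section Expectation.
Variables (R : realFieldType) (I : eqType) (p : R).
Implicit Types (A B : pred I) (b : I -> bool) (f g : (I -> bool) -> R).

(** The family [b] with the value [c] at [e]. *)
Definition update b e c : I -> bool := fun e' => if e' == e then c else b e'.

(** The mean of [f] when the coordinate [e] is redrawn from the Bernoulli law
    of parameter [p]. *)
Definition resample e f : (I -> bool) -> R :=
  fun b => p * f (update b e true) + (1 - p) * f (update b e false).

(** All the coordinates in [s] are redrawn. *)
Definition resamples (s : seq I) f := foldr resample f s.

(** The expectation of a finitary function under the product of Bernoulli laws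
    of parameter [p]: all the coordinates on which it depends are redrawn, so
    that the starting point is immaterial.  The value is 0 for a function which
    is not finitary. *)
Definition Ex f : R :=
  if pselect (finitary f) is left h then resamples (projT1 (cid h)) f xpred0
  else 0.

(** The probability of a finitary event. *)
Definition Pr (A : (I -> bool) -> bool) : R := Ex (fun b => (A b)%:R).

Lemma resample_depends A e f :
  depends_on A f -> depends_on [pred x | A x && (x != e)] (resample e f).
Proof.
move=> fA b b' bb'; rewrite /resample.
by congr (_ * _ + _ * _); apply: fA => x Ax; rewrite /update; case: ifP => // xe;
  apply: bb'; rewrite /= Ax xe.
Qed.

Lemma resampleC e e' f :
  resample e (resample e' f) = resample e' (resample e f).
Proof.
have [->//|ee'] := eqVneq e e'.
apply/funext => b; rewrite /resample.
have H c c' : update (update b e c) e' c' = update (update b e' c') e c.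
  apply/funext => x; rewrite /update; have [->|//] := eqVneq x e'.
  by rewrite eq_sym (negbTE ee').
by rewrite !H; ring.
Qed.

Lemma resamples_resample s e f :
  resamples s (resample e f) = resample e (resamples s f).
Proof. by elim: s => //= x s ->; rewrite resampleC. Qed.

Lemma resamplesC s t f :
  resamples s (resamples t f) = resamples t (resamples s f).
Proof. by elim: s => //= e s ->; rewrite resamples_resample. Qed.

Lemma resamples_cat s t f :
  resamples (s ++ t) f = resamples s (resamples t f).
Proof. exact: foldr_cat. Qed.

Lemma resamples_cst s c : resamples s (fun=> c) = fun=> c.
Proof.
elim: s => //= e s ->; apply/funext => b; rewrite /resample; ring.
Qed.

Lemma resamples_depends A s f :
  depends_on A f -> depends_on [pred x | A x && (x \notin s)] (resamples s f).
Proof.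
move=> fA; elim: s => [|e s IH] /=.
  by apply: depends_on_sub fA => x /= ->.
apply: depends_on_sub (resample_depends IH) => x /=.
by rewrite inE negb_or; case: (A x); case: (x == e); case: (x \in s).
Qed.

(** Once all the relevant coordinates are redrawn, nothing depends on the
    starting point. *)
Lemma resamples_const s f b b' :
  depends_on (mem s) f -> resamples s f b = resamples s f b'.
Proof. by move=> /(@resamples_depends _ s); apply => x /=; case: (x \in s). Qed.

(** The choice of the finite set of redrawn coordinates is immaterial too: two
    choices commute and both give constants. *)
Lemma Ex_resamples s f b : depends_on (mem s) f -> Ex f = resamples s f b.
Proof.
move=> fs; rewrite /Ex; case: pselect => [h|[]]; last by exists s.
case: (cid h) => t /= ft.
have E1 : resamples s f = fun=> resamples s f b.
  by apply/funext => b'; exact: resamples_const.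
have E2 : resamples t f = fun=> resamples t f xpred0.
  by apply/funext => b'; exact: resamples_const.
have := congr1 (@^~ b) (resamplesC s t f).
by rewrite E1 E2 !resamples_cst.
Qed.

Lemma Ex_cst c : Ex (fun=> c) = c.
Proof. by rewrite (@Ex_resamples [::] _ xpred0). Qed.

Lemma resamplesD s c f g b :
  resamples s (fun b => c * f b + g b) b =
  c * resamples s f b + resamples s g b.
Proof.
elim: s b => [|e s IH] b //=; rewrite /resample !IH; ring.
Qed.

Lemma Ex_lin c f g : finitary f -> finitary g ->
  Ex (fun b => c * f b + g b) = c * Ex f + Ex g.
Proof.
move=> ff fg; have [s [fs gs]] := finitary_pair ff fg.
rewrite (Ex_resamples xpred0 fs) (Ex_resamples xpred0 gs) -resamplesD.
by apply: Ex_resamples; exact: (depends_on_comp2 (fun x y => c * x + y)).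
Qed.

Lemma ExD f g : finitary f -> finitary g ->
  Ex (fun b => f b + g b) = Ex f + Ex g.
Proof.
move=> ff fg; rewrite -[in RHS](mul1r (Ex f)) -Ex_lin //.
by under [in RHS]eq_fun do rewrite mul1r.
Qed.

Lemma ExZ c f : finitary f -> Ex (fun b => c * f b) = c * Ex f.
Proof.
move=> ff; rewrite -[RHS]addr0 -[in RHS](Ex_cst 0) -Ex_lin //; last exact: finitary_cst.
by under [in RHS]eq_fun do rewrite addr0.
Qed.

Lemma ExB f g : finitary f -> finitary g ->
  Ex (fun b => f b - g b) = Ex f - Ex g.
Proof.
move=> ff fg; rewrite ExD //; last exact: (finitary_comp (fun x => - x)).
under [X in _ + Ex X]eq_fun do rewrite -mulN1r.
by rewrite ExZ // mulN1r.
Qed.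

Lemma Ex_sum (J : Type) (r : seq J) (F : J -> (I -> bool) -> R) :
  (forall j, finitary (F j)) ->
  Ex (fun b => \sum_(j <- r) F j b) = \sum_(j <- r) Ex (F j).
Proof.
move=> FF; elim: r => [|j r IH].
  rewrite big_nil -[RHS]Ex_cst; congr Ex.
  by apply/funext => b; rewrite big_nil.
rewrite big_cons -IH -ExD //; last exact: finitary_big.
by congr Ex; apply/funext => b; rewrite big_cons.
Qed.

Lemma Ex_coord e (F : bool -> R) :
  Ex (fun b => F (b e)) = p * F true + (1 - p) * F false.
Proof.
rewrite (@Ex_resamples [:: e] _ xpred0) /= /resample /update ?eqxx //.
by move=> b b' -> //=; rewrite inE.
Qed.

Lemma resamples_mul A s f g : depends_on A g -> all (predC A) s ->
  resamples s (fun b => f b * g b) = fun b => resamples s f b * g b.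
Proof.
move=> gA; elim: s => //= e s IH /andP[Ae /IH ->].
apply/funext => b; rewrite /resample.
have H c : g (update b e c) = g b.
  by apply: gA => x Ax; rewrite /update; case: eqP => // xe; move: Ae; rewrite -xe Ax.
by rewrite !H; ring.
Qed.

(** Functions of disjoint sets of coordinates are independent. *)
Lemma Ex_indep A B f g : finitary f -> finitary g ->
  depends_on A f -> depends_on B g -> (forall e, A e -> ~~ B e) ->
  Ex (fun b => f b * g b) = Ex f * Ex g.
Proof.
move=> [s fs] [t gt] fA gB AB.
have fs' := depends_on_filter fA fs; have gt' := depends_on_filter gB gt.
set s' := seq.filter A s in fs'; set t' := seq.filter B t in gt'.
have E1 : resamples s' f = fun=> Ex f.
  by apply/funext => b'; rewrite (Ex_resamples b' fs').
have E2 : resamples t' g = fun=> Ex g.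
  by apply/funext => b'; rewrite (Ex_resamples b' gt').
rewrite (@Ex_resamples (t' ++ s') _ xpred0); last first.
  apply: (depends_on_comp2 (fun x y : R => x * y)).
    by apply: depends_on_sub fs' => e /= es; rewrite mem_cat es orbT.
  by apply: depends_on_sub gt' => e /= es; rewrite mem_cat es.
rewrite resamples_cat (@resamples_mul B s') //; last first.
  by apply/allP => e; rewrite mem_filter => /andP[/AB].
rewrite E1.
under [X in resamples _ X]eq_fun do rewrite mulrC.
rewrite (@resamples_mul xpred0) ?E2 //; last exact/allP.
exact: mulrC.
Qed.

Hypotheses (p0 : 0 <= p) (p1 : p <= 1).

Lemma Ex_le f g : finitary f -> finitary g -> (forall b, f b <= g b) ->
  Ex f <= Ex g.
Proof.
move=> ff fg fg'; have [s [fs gs]] := finitary_pair ff fg.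
rewrite (Ex_resamples xpred0 fs) (Ex_resamples xpred0 gs).
elim: s (xpred0 : I -> bool) {fs gs} => //= e s IH b; rewrite /resample.
by apply: lerD; apply: ler_wpM2l; rewrite ?subr_ge0.
Qed.

Lemma finitary_Pr (A : (I -> bool) -> bool) :
  finitary A -> finitary (fun b => (A b)%:R : R).
Proof. exact: (finitary_comp (fun c : bool => c%:R : R)). Qed.

Lemma Pr_markov (A : (I -> bool) -> bool) f (t : R) :
  finitary A -> finitary f -> 0 < t -> (forall b, 0 <= f b) ->
  (forall b, A b -> t <= f b) -> Pr A <= Ex f / t.
Proof.
move=> fA ff t0 f0 At; rewrite mulrC -ExZ //; apply: Ex_le.
- exact: finitary_Pr.
- exact: (finitary_comp (fun x => t^-1 * x)).
- move=> b; case: (boolP (A b)) => Ab; last by rewrite mulr_ge0 ?invr_ge0 ?(ltW t0).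
  by rewrite mulrC ler_pdivlMr // mul1r; exact: At.
Qed.

Lemma PrC (A : (I -> bool) -> bool) : finitary A ->
  Pr (fun b => ~~ A b) = 1 - Pr A.
Proof.
move=> fA; rewrite /Pr -[X in X - _](Ex_cst 1) -ExB; last exact: finitary_Pr.
  by congr Ex; apply/funext => b; case: (A b); rewrite /= ?subrr ?subr0.
exact: finitary_cst.
Qed.

End Expectation.
Arguments Ex_cst {R I} p c.

(** Invariance under an injective relabelling of the coordinates. *)
Lemma Ex_relabel (R : realFieldType) (I J : eqType) (p : R) (h : I -> J)
    (f : (I -> bool) -> R) : injective h -> finitary f ->
  Ex p (fun b => f (fun e => b (h e))) = Ex p f.
Proof.
move=> hI [s fs].
rewrite (@Ex_resamples _ _ p (map h s) _ xpred0); last first.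
  by move=> b b' bb'; apply: fs => e es; apply: bb' => /=; exact: map_f.
rewrite (Ex_resamples p (fun e => xpred0 (h e)) fs).
suff H b : resamples p (map h s) (fun b => f (fun e => b (h e))) b =
    resamples p s f (fun e => b (h e)) by exact: H.
elim: s {fs} b => //= e s IH b.
rewrite /resample !IH.
have H c : (fun x => update b (h e) c (h x)) = update (fun x => b (h x)) e c.
  by apply/funext => x; rewrite /update (inj_eq hI).
by rewrite !H.
Qed.

(** * Passage times with weights 1 and 2 *)

Section Distance.
Implicit Types (b : edge -> bool) (u v x y z : Z2) (p : seq Z2).

(** The l1 distance, which is the graph distance of the square lattice. *)
Definition l1 (u v : Z2) : nat := (absz (u.1 - v.1) + absz (u.2 - v.2))%N.

Lemma neighbourE u v : neighbour u v = (l1 u v == 1)%N.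
Proof. by rewrite /neighbour /l1; lia. Qed.

Lemma l1_triangle u v w : (l1 u w <= l1 u v + l1 v w)%N.
Proof. by rewrite /l1; lia. Qed.

Lemma l1C u v : l1 u v = l1 v u.
Proof. by rewrite /l1; lia. Qed.

Lemma l1xx u : l1 u u = 0%N.
Proof. by rewrite /l1; lia. Qed.

Lemma l1_eq0 u v : (l1 u v == 0)%N -> u = v.
Proof. by case: u v => [a c] [a' c']; rewrite /l1 /= => h; congr (_, _); lia. Qed.

Lemma lattice_path x y :
  exists p, [/\ path neighbour x p, last x p = y & size p = l1 x y].
Proof.
move: {2}(l1 x y) (erefl (l1 x y)) => n; elim: n x y => [|n IH] x y xy.
  by exists [::]; split => //=; apply: l1_eq0; rewrite xy.
have [x' [xx' x'y]] : exists x', neighbour x x' /\ l1 x' y = n.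
  case: x y xy => [a c] [a' c'] xy; rewrite /l1 /= in xy.
  have [aa'|aa'|aa'] := ltgtP a a'.
  - by exists (a + 1, c); rewrite /neighbour /l1 /=; lia.
  - by exists (a - 1, c); rewrite /neighbour /l1 /=; lia.
  - have [cc'|cc'|cc'] := ltgtP c c'.
    + by exists (a, c + 1); rewrite /neighbour /l1 /=; lia.
    + by exists (a, c - 1); rewrite /neighbour /l1 /=; lia.
    + lia.
have [p [px py ps]] := IH x' y x'y.
by exists (x' :: p); split => //=; [rewrite xx' | rewrite ps x'y xy].
Qed.

(** An edge costs 2 when its coin shows [true] and 1 otherwise. *)
Definition time b x p : nat := (\sum_(e <- pairmap edge_of x p) (b e).+1)%N.

Lemma pairmap_cat_edge x p q :
  pairmap edge_of x (p ++ q) = pairmap edge_of x p ++ pairmap edge_of (last x p) q.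
Proof. by elim: p x => //= y p IH x; rewrite IH. Qed.

Lemma time_cat b x p q : time b x (p ++ q) = (time b x p + time b (last x p) q)%N.
Proof. by rewrite /time pairmap_cat_edge big_cat. Qed.

Lemma time_ge_size b x p : (size p <= time b x p)%N.
Proof.
rewrite /time -(size_pairmap edge_of x p) -sum1_size.
by apply: leq_sum => e _.
Qed.

Lemma time_le_size b x p : (time b x p <= 2 * size p)%N.
Proof.
rewrite /time -(size_pairmap edge_of x p) -sum1_size big_distrr /=.
by apply: leq_sum => e _; case: (b e).
Qed.

Lemma l1_path x p : path neighbour x p -> (l1 x (last x p) <= size p)%N.
Proof.
elim: p x => [|y p IH] x /=; first by rewrite /l1; lia.
by rewrite neighbourE => /andP[/eqP xy /IH]; have := l1_triangle x y (last y p); lia.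
Qed.

Lemma path_edges_near z x p : path neighbour x p ->
  {in pairmap edge_of x p, forall e, (l1 z (edge_src e) <= l1 z x + size p)%N}.
Proof.
elim: p x => [|y p IH] x //= /andP[xy yp] e; rewrite inE => /orP[/eqP ->|ep].
  have := xy; rewrite neighbourE => /eqP l1xy.
  have := l1_triangle z x y.
  by case: (ends_edge_of xy) => -[-> _]; lia.
have := IH _ yp _ ep; move: xy; rewrite neighbourE => /eqP.
by have := l1_triangle z x y; lia.
Qed.

Lemma distance_ex b x y :
  exists n, `[< exists p, [/\ path neighbour x p, last x p = y & time b x p = n] >].
Proof.
by have [p [px py _]] := lattice_path x y; exists (time b x p); apply/asboolP; exists p.
Qed.

(** The passage time in the environment [b]; the infimum over the paths is a
    minimum because the times are natural numbers. *)
Definition distance b x y : nat := ex_minn (distance_ex b x y).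

Lemma distance_le b x y p :
  path neighbour x p -> last x p = y -> (distance b x y <= time b x p)%N.
Proof.
move=> px py; rewrite /distance; case: ex_minnP => m _; apply.
by apply/asboolP; exists p.
Qed.

Lemma geodesic b x y : exists p,
  [/\ path neighbour x p, last x p = y & time b x p = distance b x y].
Proof. by rewrite /distance; case: ex_minnP => m /asboolP. Qed.

Lemma distancexx b x : distance b x x = 0%N.
Proof.
have := @distance_le b x x [::] isT erefl.
by rewrite /time /= big_nil leqn0 => /eqP.
Qed.

Lemma distance_triangle b x y z :
  (distance b x z <= distance b x y + distance b y z)%N.
Proof.
have [p [px py <-]] := geodesic b x y; have [q [qy qz <-]] := geodesic b y z.
rewrite -{1}py -time_cat; apply: distance_le.
  by rewrite cat_path px py.
by rewrite last_cat py.
Qed.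

Lemma distance_ge b x y : (l1 x y <= distance b x y)%N.
Proof.
have [p [px <- <-]] := geodesic b x y.
exact: leq_trans (l1_path px) (time_ge_size _ _ _).
Qed.

Lemma distance_le2 b x y : (distance b x y <= 2 * l1 x y)%N.
Proof.
have [p [px py <-]] := lattice_path x y.
exact: leq_trans (distance_le _ px py) (time_le_size _ _ _).
Qed.

(** The edges whose source is within distance [r] of [x]. *)
Definition edge_near x (r : nat) : pred edge := fun e => (l1 x (edge_src e) <= r)%N.

(** A geodesic has at most [2 * l1 x y] edges, hence stays near [x]. *)
Lemma distance_local x y :
  depends_on (edge_near x (2 * l1 x y)) (fun b => distance b x y).
Proof.
have H b1 b2 : (forall e, edge_near x (2 * l1 x y) e -> b1 e = b2 e) ->
    (distance b1 x y <= distance b2 x y)%N.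
  move=> b12; have [p [px py tp]] := geodesic b2 x y.
  rewrite -tp; suff <- : time b1 x p = time b2 x p by exact: distance_le.
  rewrite /time !big_seq; apply: eq_bigr => e ep; rewrite b12 // /edge_near.
  have /= h1 := path_edges_near x px ep; have h2 := time_ge_size b2 x p.
  have h3 := distance_le2 b2 x y; rewrite tp in h2; rewrite l1xx in h1.
  exact: leq_trans h1 (leq_trans h2 h3).
move=> b1 b2 b12; apply/eqP; rewrite eqn_leq !H // => e /b12 //.
Qed.

(** A finite list containing all the edges near [x]. *)
Definition box x (r : nat) : seq edge :=
  [seq (u, c) | u <- [seq (x.1 + i%:Z - r%:Z, x.2 + j%:Z - r%:Z)
                       | i <- iota 0 (2 * r).+1, j <- iota 0 (2 * r).+1],
                c <- [:: true; false]].

Lemma mem_box x r e : edge_near x r e -> e \in box x r.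
Proof.
case: x e => [a c] [[a' c'] o]; rewrite /edge_near /l1 /= => h.
apply: (allpairs_f (fun (u : Z2) (o : bool) => (u, o))); last by case: o h; rewrite !inE.
have -> : (a', c') = (a + (absz (a' - a + r%:Z))%:Z - r%:Z,
                      c + (absz (c' - c + r%:Z))%:Z - r%:Z) :> Z2.
  by congr (_, _); lia.
apply: (allpairs_f (fun i j : nat => (a + i%:Z - r%:Z, c + j%:Z - r%:Z))).
- by rewrite mem_iota; lia.
- by rewrite mem_iota; lia.
Qed.

Lemma finitary_near (T : Type) x r (f : (edge -> bool) -> T) :
  depends_on (edge_near x r) f -> finitary f.
Proof. by move=> fn; exists (box x r); apply: depends_on_sub fn => e /mem_box. Qed.

Lemma finitary_distance x y : finitary (fun b => distance b x y).
Proof. exact: finitary_near (@distance_local x y). Qed.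

End Distance.

Section Symmetry.
Variables (g g' : Z2 -> Z2).
Hypotheses (gK : cancel g g') (g'K : cancel g' g).
Hypothesis g_neighbour : forall u v, neighbour u v -> neighbour (g u) (g v).
Hypothesis g'_neighbour : forall u v, neighbour u v -> neighbour (g' u) (g' v).

(** The action on the edges of an automorphism [g] of the square lattice. *)
Definition edge_image (e : edge) : edge := edge_of (g (edge_src e)) (g (edge_tgt e)).

Lemma edge_image_of u v : neighbour u v ->
  edge_image (edge_of u v) = edge_of (g u) (g v).
Proof.
move=> uv; rewrite /edge_image; case: (ends_edge_of uv) => -[-> ->] //.
by rewrite edge_ofC // g_neighbour // /neighbour; move: uv; rewrite /neighbour; lia.
Qed.

Lemma edge_image_inj : injective edge_image.
Proof.
move=> e e' ee'; have ne := neighbour_edge e; have ne' := neighbour_edge e'.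
have := ends_edge_of (g_neighbour ne); have := ends_edge_of (g_neighbour ne').
rewrite -/(edge_image e) -/(edge_image e') ee' => E1 E2.
suff [[E3 E4]|[E3 E4]] : (edge_src e, edge_tgt e) = (edge_src e', edge_tgt e') \/
    (edge_src e, edge_tgt e) = (edge_tgt e', edge_src e').
- by rewrite -(edge_of_ends e) E3 E4 edge_of_ends.
- by rewrite -(edge_of_ends e) E3 E4 -edge_ofC // edge_of_ends.
case: E1 E2 => -[-> ->] [] -[/(can_inj gK) -> /(can_inj gK) ->];
  by [left | right].
Qed.

Lemma path_map_nb (h : Z2 -> Z2) x p :
  (forall u v, neighbour u v -> neighbour (h u) (h v)) ->
  path neighbour x p -> path neighbour (h x) (map h p).
Proof. by move=> hn; elim: p x => //= y p IH x /andP[/hn -> /IH]. Qed.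

Lemma time_image b x p : path neighbour x p ->
  time (fun e => b (edge_image e)) x p = time b (g x) (map g p).
Proof.
rewrite /time; elim: p x => [|y p IH] x /=; first by rewrite !big_nil.
by move=> /andP[xy /IH yp]; rewrite !big_cons yp edge_image_of.
Qed.

Lemma distance_image b x y :
  distance (fun e => b (edge_image e)) x y = distance b (g x) (g y).
Proof.
apply/eqP; rewrite eqn_leq; apply/andP; split.
- have [p [px py <-]] := geodesic b (g x) (g y).
  have p'x : path neighbour x (map g' p).
    by rewrite -(gK x); exact: path_map_nb.
  rewrite -[p in time _ _ p](mapK g'K) -time_image //.
  by apply: distance_le => //; rewrite -(gK x) last_map py gK.
- have [p [px py <-]] := geodesic (fun e => b (edge_image e)) x y.
  rewrite time_image //; apply: distance_le; first exact: path_map_nb.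
  by rewrite last_map py.
Qed.

Lemma Ex_distance_image (R : realFieldType) (p : R) x y :
  Ex p (fun b => (distance b (g x) (g y))%:R) = Ex p (fun b => (distance b x y)%:R).
Proof.
rewrite -(@Ex_relabel R _ _ p edge_image (fun b => (distance b x y)%:R)).
- by congr (Ex p _); apply/funext => b; rewrite distance_image.
- exact: edge_image_inj.
- exact: (finitary_comp (fun n => n%:R)) (finitary_distance _ _).
Qed.

End Symmetry.

(** * Mean passage times and sums of consecutive hops *)

Section MeanDistance.
Variables (R : realFieldType) (p : R).
Implicit Types (u v x y z c : Z2).

Lemma l1_shift c u v : l1 (u + c) (v + c) = l1 u v.
Proof. by case: u v c => [? ?] [? ?] [? ?]; rewrite /l1 /=; lia. Qed.

Lemma Z2_mulrn x n : x *+ n = (x.1 *+ n, x.2 *+ n).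
Proof. by elim: n => // n IH; rewrite !mulrS IH; case: x {IH}. Qed.

(** The l1 norm. *)
Definition norm1 x : nat := l1 0 x.

Lemma l1_mul x n : norm1 (x *+ n) = (n * norm1 x)%N.
Proof.
rewrite Z2_mulrn /norm1 /l1 /= !sub0r !abszN -(mulr_natr x.1) -(mulr_natr x.2) !abszM !natz.
by rewrite -mulnDl mulnC.
Qed.

(** The mean passage time. *)
Definition Ed x y : R := Ex p (fun b => (distance b x y)%:R).

Lemma finitary_distanceR x y : finitary (fun b => (distance b x y)%:R : R).
Proof. exact: (finitary_comp (fun n : nat => n%:R : R)) (finitary_distance x y). Qed.

Lemma Ed_shift c x y : Ed (x + c) (y + c) = Ed x y.
Proof.
apply: (@Ex_distance_image (fun u => u + c) (fun u => u - c)).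
- by move=> u; rewrite addrK.
- by move=> u; rewrite subrK.
- by move=> u v; rewrite !neighbourE l1_shift.
- by move=> u v; rewrite !neighbourE l1_shift.
Qed.

Lemma Ed_sub x y : Ed x y = Ed 0 (y - x).
Proof. by rewrite -(Ed_shift x 0) add0r subrK. Qed.

Lemma Ed_image (g g' : Z2 -> Z2) x y : cancel g g' -> cancel g' g ->
  (forall u v, l1 (g u) (g v) = l1 u v) -> Ed (g x) (g y) = Ed x y.
Proof.
move=> gK g'K gl; apply: (@Ex_distance_image g g') => // u v.
  by rewrite !neighbourE gl.
by rewrite !neighbourE -(gl (g' u)) !g'K.
Qed.

Hypotheses (p0 : 0 <= p) (p1 : p <= 1).

Lemma Ed_triangle x y z : Ed x z <= Ed x y + Ed y z.
Proof.
rewrite /Ed -ExD; try exact: finitary_distanceR.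
apply: Ex_le => //; first exact: finitary_distanceR.
  by apply: (finitary_comp2 (fun s t : R => s + t)); exact: finitary_distanceR.
by move=> b; rewrite -natrD ler_nat distance_triangle.
Qed.

Lemma Ed_ge x y : (l1 x y)%:R <= Ed x y.
Proof.
rewrite -[X in X <= _](@Ex_cst R edge p); apply: Ex_le => //; first exact: finitary_cst.
  exact: finitary_distanceR.
by move=> b; rewrite ler_nat distance_ge.
Qed.

Lemma Ed_ge0 x y : 0 <= Ed x y.
Proof. exact: le_trans (ler0n _ _) (Ed_ge _ _). Qed.

Lemma finitary_time x q : finitary (fun b => (time b x q)%:R : R).
Proof.
apply: (finitary_comp (fun n : nat => n%:R : R)); apply: finitary_big => e.
exact: (finitary_comp (fun c : bool => c.+1)) (finitary_coord e).
Qed.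

Lemma Ex_time x q : Ex p (fun b => (time b x q)%:R) = (1 + p) * (size q)%:R.
Proof.
rewrite /time.
under eq_fun do rewrite natr_sum.
rewrite Ex_sum; last by move=> e;
  exact: (finitary_comp (fun c : bool => c.+1%:R)) (finitary_coord e).
under eq_bigr => e _ do rewrite (Ex_coord p e (fun c : bool => c.+1%:R : R)).
by rewrite big_const_seq count_predT size_pairmap iter_addr_0 -[LHS]mulr_natr;
  congr (_ * _); rewrite /=; ring.
Qed.

Lemma Ed_le x y : Ed x y <= (1 + p) * (l1 x y)%:R.
Proof.
have [q [qx qy <-]] := lattice_path x y; rewrite -(Ex_time x q).
apply: Ex_le => //; [exact: finitary_distanceR | exact: finitary_time |].
by move=> b; rewrite ler_nat; exact: distance_le.
Qed.

Lemma Ed_add x y : Ed 0 (x + y) <= Ed 0 x + Ed 0 y.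
Proof.
by apply: le_trans (Ed_triangle 0 x (x + y)) _; rewrite (Ed_sub x) addrAC subrr add0r.
Qed.

Lemma Ed00 : Ed 0 0 = 0.
Proof.
rewrite /Ed -[RHS](@Ex_cst R edge p); congr Ex.
by apply/funext => b; rewrite distancexx.
Qed.

Lemma Ed_mul x n : Ed 0 (x *+ n) <= n%:R * Ed 0 x.
Proof.
elim: n => [|n IH]; first by rewrite mulr0n mul0r Ed00.
rewrite mulrSr -natr1 mulrDl mul1r.
by apply: le_trans (Ed_add _ _) _; rewrite lerD2r.
Qed.

(** Of two edge-disjoint paths of the same length [n], the quicker one wastes at
    most the product of the two wastes, whose mean is [(n p)^2]. *)
Lemma Ed_two_paths x y (q q' : seq Z2) (n : nat) :
  path neighbour x q -> path neighbour x q' -> last x q = y -> last x q' = y ->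
  size q = n -> size q' = n ->
  (forall e, e \in pairmap edge_of x q -> e \notin pairmap edge_of x q') ->
  Ed x y <= n%:R + (n%:R * p) ^+ 2.
Proof.
move=> xq xq' qy q'y qn q'n dis.
pose W q b : R := \sum_(e <- pairmap edge_of x q) (b e)%:R.
have fW r : finitary (W r).
  by apply: finitary_big => e; exact: (finitary_comp (fun c : bool => c%:R)) (finitary_coord e).
have dW r : depends_on (mem (pairmap edge_of x r)) (W r).
  by move=> b b' bb'; rewrite /W !big_seq; apply: eq_bigr => e er; rewrite bb'.
have EW r : Ex p (W r) = (size r)%:R * p.
  rewrite Ex_sum; last by move=> e;
    exact: (finitary_comp (fun c : bool => c%:R)) (finitary_coord e).
  under eq_bigr => e _ do rewrite (Ex_coord p e (fun c : bool => c%:R : R)).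
  by rewrite big_const_seq count_predT size_pairmap iter_addr_0 -[LHS]mulr_natl;
    congr (_ * _); rewrite /=; ring.
have tW r b : (time b x r)%:R = (size r)%:R + W r b.
  rewrite /time natr_sum /W -(size_pairmap edge_of x r) -sum1_size natr_sum -big_split /=.
  by apply: eq_bigr => e _; rewrite -natrD add1n.
have -> : (n%:R * p) ^+ 2 = Ex p (fun b => W q b * W q' b).
  rewrite (Ex_indep p (fW q) (fW q') (dW q) (dW q')) ?EW ?qn ?q'n ?expr2 //.
rewrite -[X in X + _](@Ex_cst R edge p) -ExD; last exact: (finitary_comp2 (fun s t : R => s * t)).
- apply: Ex_le => //; first exact: finitary_distanceR.
    apply: (finitary_comp (fun t : R => n%:R + t)).
    exact: (finitary_comp2 (fun s t : R => s * t)).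
  move=> b.
  have H r : path neighbour x r -> last x r = y -> size r = n ->
      (distance b x y)%:R <= n%:R + W r b.
    by move=> xr ry <-; rewrite -tW ler_nat distance_le.
  have := H _ xq qy qn; have := H _ xq' q'y q'n.
  have [k ->] : exists k : nat, W q b = k%:R.
    by exists (\sum_(e <- pairmap edge_of x q) (b e))%N; rewrite natr_sum.
  have [k' ->] : exists k : nat, W q' b = k%:R.
    by exists (\sum_(e <- pairmap edge_of x q') (b e))%N; rewrite natr_sum.
  (* the minimum of two natural numbers is at most their product unless one of
     them is 0, in which case both vanish *)
  rewrite -!natrM -!natrD !ler_nat; case: k => [|k]; first by lia.
  by case: k' => [|k']; nia.
- exact: finitary_cst.
Qed.

Section Hops.
Variables (x y : Z2).

(** The passage time of the [k]-th step of length [x] on the line from [y] in the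
    direction [x]. *)
Definition hop k b : nat := distance b (y + x *+ k) (y + x *+ k.+1).

(** The total time of the first [n] hops. *)
Definition hops n b : nat := (\sum_(k < n) hop k b)%N.

Lemma finitary_hops n : finitary (hops n).
Proof. by apply: finitary_big => k; exact: finitary_distance. Qed.

Lemma distance_hops n b : (distance b y (y + x *+ n)%R <= hops n b)%N.
Proof.
rewrite /hops; elim: n => [|n IH]; first by rewrite mulr0n addr0 distancexx.
rewrite big_ord_recr /=; apply: leq_trans (distance_triangle _ _ (y + x *+ n) _) _.
by rewrite leq_add2r.
Qed.

Lemma Ex_hop k : Ex p (fun b => (hop k b)%:R) = Ed 0 x.
Proof.
rewrite -[LHS]/(Ed (y + x *+ k) (y + x *+ k.+1)) Ed_sub.
by congr (Ed _ _); rewrite mulrSr addrA [_ + x]addrC addrK.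
Qed.

Lemma Ex_hops n : Ex p (fun b => (hops n b)%:R) = n%:R * Ed 0 x.
Proof.
rewrite /hops; under eq_fun do rewrite natr_sum.
rewrite Ex_sum; last by move=> k; exact: finitary_distanceR.
under eq_bigr => k _ do rewrite Ex_hop.
by rewrite sumr_const card_ord mulr_natl.
Qed.

Let L : R := (2 * norm1 x)%:R.
Let X k b : R := (hop k b)%:R - Ed 0 x.

Let l1_hop k : l1 (y + x *+ k) (y + x *+ k.+1) = norm1 x.
Proof.
by rewrite -(l1_shift (- (y + x *+ k))) subrr mulrSr addrA [_ + x]addrC addrK.
Qed.

Let hop_le k b : (hop k b)%:R <= L.
Proof. by rewrite ler_nat -(l1_hop k) distance_le2. Qed.

Let Ed_leL : Ed 0 x <= L.
Proof.
rewrite -(Ex_hop 0) -(@Ex_cst R edge p L); apply: Ex_le => //.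
- exact: finitary_distanceR.
- exact: finitary_cst.
Qed.

Let X_le k b : `|X k b| <= L.
Proof.
rewrite ler_norml; have := hop_le k b; have := Ed_leL; have := Ed_ge0 0 x.
have : (0 : R) <= (hop k b)%:R by exact: ler0n.
by rewrite /X => *; apply/andP; split; lra.
Qed.

Let finitary_X k : finitary (X k).
Proof. exact: (finitary_comp (fun t => t - _)) (finitary_distanceR _ _). Qed.

Let Ex_X k : Ex p (X k) = 0.
Proof.
rewrite ExB ?Ex_hop ?Ex_cst ?subrr //; last exact: finitary_cst.
exact: finitary_distanceR.
Qed.

Let X_near k : depends_on (edge_near (y + x *+ k) (2 * norm1 x)) (X k).
Proof.
move=> b b' bb'; rewrite /X /hop (distance_local (b' := b')) //.
by rewrite l1_hop.
Qed.

(* Hops at index distance at least 5 depend on disjoint sets of edges. *)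
Let ExXX k k' : (k + 5 <= k')%N -> Ex p (fun b => X k b * X k' b) = 0.
Proof.
move=> kk'; have [l0|l0] := eqVneq (norm1 x) 0%N.
  rewrite -[RHS](@Ex_cst R edge p); congr Ex; apply/funext => b.
  have := X_le k b; rewrite /L l0 muln0 normr_le0 => /eqP ->.
  by rewrite mul0r.
rewrite (Ex_indep p (finitary_X k) (finitary_X k') (@X_near k) (@X_near k')).
  by rewrite Ex_X mul0r.
move=> e; rewrite /edge_near => h1; apply/negP => h2.
have := l1_triangle (y + x *+ k) (edge_src e) (y + x *+ k').
rewrite [l1 (edge_src e) _]l1C -(l1_shift (- (y + x *+ k))) subrr.
rewrite opprD addrACA subrr add0r -mulrnBr; last by lia.
by rewrite -/(norm1 _) l1_mul; nia.
Qed.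

Let count_close n : (\sum_(k < n) (n < k + 5) <= 4)%N.
Proof.
rewrite -(big_mkord xpredT (fun k => nat_of_bool (n < k + 5)%N)) big_nat_rev /= add0n.
rewrite (_ : (\sum_(0 <= i < n) _ = \sum_(0 <= i < n) (i < 4))%N); last first.
  by apply: eq_big_nat => i /andP[_ ni]; congr nat_of_bool; lia.
elim: n => [|n IH]; first by rewrite big_geq.
have [n4|n4] := ltnP n 4.
  rewrite (@leq_trans (\sum_(0 <= i < n.+1) 1)%N) //.
    by apply: leq_sum => i _; case: (i < 4)%N.
  by rewrite sum_nat_const_nat; lia.
by rewrite big_nat_recr //= [(n < 4)%N]ltnNge n4 addn0.
Qed.

(** Only neighbouring hops are correlated, so that the variance is linear. *)
Lemma hops_variance n :
  Ex p (fun b => ((hops n b)%:R - n%:R * Ed 0 x) ^+ 2) <= 9%:R * L ^+ 2 * n%:R.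
Proof.
pose S n b := \sum_(k < n) X k b.
have -> : (fun b => ((hops n b)%:R - n%:R * Ed 0 x) ^+ 2) = (fun b => S n b ^+ 2).
  apply/funext => b; congr (_ ^+ 2).
  by rewrite /S sumrB sumr_const card_ord mulr_natl /hops natr_sum.
have fS m : finitary (S m) by exact: finitary_big.
have fM f g : finitary f -> finitary g -> finitary (fun b => f b * g b : R).
  exact: finitary_comp2.
elim: n => [|n IH].
  rewrite mulr0 (_ : (fun b => _) = fun=> 0) ?Ex_cst //.
  by apply/funext => b; rewrite /S big_ord0 expr0n.
have -> : (fun b => S n.+1 b ^+ 2) =
    (fun b => 2%:R * (S n b * X n b) + (1 * S n b ^+ 2 + X n b ^+ 2)).
  by apply/funext => b; rewrite /S big_ord_recr /=; ring.
rewrite Ex_lin; last 2 first.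
- exact: fM.
- by apply: (finitary_comp2 (fun s t : R => 1 * s ^+ 2 + t ^+ 2)).
rewrite Ex_lin; last 2 first.
- exact: (finitary_comp (fun t => t ^+ 2)).
- exact: (finitary_comp (fun t => t ^+ 2)).
have XX k k' : Ex p (fun b => X k b * X k' b) <= L ^+ 2.
  rewrite -(@Ex_cst R edge p (L ^+ 2)); apply: Ex_le => //; [exact: fM | exact: finitary_cst |].
  move=> b; apply: le_trans (ler_norm _) _; rewrite normrM expr2.
  by apply: ler_pM.
have SX : Ex p (fun b => S n b * X n b) <= 4%:R * L ^+ 2.
  have -> : (fun b => S n b * X n b) = fun b => \sum_(k < n) (X k b * X n b).
    by apply/funext => b; rewrite /S mulr_suml.
  rewrite Ex_sum; last by move=> k; exact: fM.
  apply: (@le_trans _ _ (\sum_(k < n) (nat_of_bool (n < k + 5)%N)%:R * L ^+ 2)).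
    apply: ler_sum => k _; case: ltnP => kn; first by rewrite mul1r.
    by rewrite ExXX // mul0r.
  by rewrite -mulr_suml -natr_sum ler_wpM2r ?sqr_ge0 // ler_nat count_close.
have XXn : Ex p (fun b => X n b ^+ 2) <= L ^+ 2.
  by rewrite (_ : (fun b => _) = fun b => X n b * X n b) //; apply/funext => b; rewrite expr2.
rewrite -natr1; lra.
Qed.

(** Chebyshev's inequality for the passage times of consecutive equal hops. *)
Lemma hops_deviation n (t : R) : 0 < t ->
  Pr p (fun b => t <= `|(hops n b)%:R - n%:R * Ed 0 x|) <= 9%:R * L ^+ 2 * n%:R / t ^+ 2.
Proof.
move=> t0; have t20 : 0 < t ^+ 2 by rewrite exprn_gt0.
pose V (m : nat) : R := (m%:R - n%:R * Ed 0 x) ^+ 2.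
apply: (@le_trans _ _ (Ex p (fun b => V (hops n b)) / t ^+ 2)); last first.
  by rewrite ler_pM2r ?invr_gt0 //; exact: hops_variance.
apply: Pr_markov => //.
- exact: (finitary_comp (fun m : nat => t <= `|m%:R - n%:R * Ed 0 x|)) (finitary_hops n).
- exact: finitary_comp (finitary_hops n).
- by move=> b; exact: sqr_ge0.
- move=> b tb; rewrite /V -[X in _ <= X]real_normK ?num_real //.
  by rewrite ler_sqr ?nnegrE ?normr_ge0 ?(ltW t0).
Qed.

End Hops.
End MeanDistance.

(** * The asymptotic advantage of a point in its own direction *)

Section Advantage.
Variables (R : realType) (p : R).
Hypotheses (p0 : 0 <= p) (p1 : p <= 1).
Implicit Types (v q : Z2).

(** A sequence which stays above slope [s] has infinitely many increments at
    least equal to any smaller [t]. *)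
Lemma increment_ge (c : nat -> R) (s t : R) : t < s ->
  (forall k, k%:R * s <= c k) ->
  forall k0, exists k, (k0 <= k)%N /\ t <= c k.+1 - c k.
Proof.
move=> ts cs k0; apply: contrapT => H.
have step k : (k0 <= k)%N -> c k.+1 <= c k + t.
  move=> k0k; have [//|/ltW h] := leP (c k.+1) (c k + t).
  by case: H; exists k; split => //; lra.
have lin j : c (k0 + j)%N <= c k0 + j%:R * t.
  elim: j => [|j IH]; first by rewrite addn0 mul0r addr0.
  rewrite addnS -natr1; apply: le_trans (step _ (leq_addr _ _)) _; lra.
pose j := (Num.trunc (`|c k0 - k0%:R * s| / (s - t))).+1.
have st : 0 < s - t by rewrite subr_gt0.
have : `|c k0 - k0%:R * s| / (s - t) < j%:R.
  exact: truncnS_gt.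
rewrite ltr_pdivrMr // => hj.
have := le_trans (cs (k0 + j)%N) (lin j); rewrite natrD.
have := ler_norm (c k0 - k0%:R * s); lra.
Qed.

Lemma common_gap (T : eqType) (F : T -> R) (s : seq T) (c : R) :
  (forall q : T, q \in s -> F q < c) ->
  exists2 g, 0 < g & forall q : T, q \in s -> F q <= c - 4%:R * g.
Proof.
elim: s => [|q s IH] Fs; first by exists 1.
have [g g0 Hg] : exists2 g, 0 < g & forall q : T, q \in s -> F q <= c - 4%:R * g.
  by apply: IH => q' q's; apply: Fs; rewrite inE q's orbT.
have Fq : F q < c by apply: Fs; rewrite inE eqxx.
exists (Num.min g ((c - F q) / 4%:R)).
  by rewrite lt_min g0 /= divr_gt0 // subr_gt0.
move=> q'; rewrite inE => /orP[/eqP ->|/Hg h].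
  have : Num.min g ((c - F q) / 4%:R) <= (c - F q) / 4%:R by rewrite ge_min lexx orbT.
  lra.
have : Num.min g ((c - F q) / 4%:R) <= g by rewrite ge_min lexx.
lra.
Qed.

(** The site [z] is strictly closer to [x] than to all the points of [s]. *)
Definition wins (x : Z2) (s : seq Z2) (z : Z2) (b : edge -> bool) : bool :=
  all (fun y => (distance b x z < distance b y z)%N) s.

Lemma finitary_wins x s z : finitary (wins x s z).
Proof.
elim: s => [|y s IH]; first exact: finitary_cst.
apply: (finitary_comp2 (fun c c' : bool => c && c')) IH.
apply: (finitary_comp2 (fun m n : nat => (m < n)%N)); exact: finitary_distance.
Qed.

(** The passage time from the dilated point [v *+ N] to a far point in its own
    direction is smaller, with high probability, than those from the dilated
    points [q *+ N]. *)
Lemma wins_likely (v : Z2) (s : seq Z2) (kappa eta : R) :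
  (forall m, (0 < m)%N -> m%:R * kappa <= Ed p 0 (v *+ m)) ->
  (forall q, q \in s -> Ed p 0 (v + q) < 2%:R * kappa) -> 0 < eta ->
  exists2 N0, (0 < N0)%N & forall N, (0 < N)%N -> (N0 %| N)%N ->
    forall n0, exists n, (n0 <= n)%N /\
      1 - eta <= Pr p (wins (v *+ N) [seq q *+ N | q <- s] (v *+ n)).
Proof.
move=> kapP sP eta0.
pose a (m : nat) := Ed p 0 (v *+ m).
pose S : set R := [set r | exists2 m, (0 < m)%N & r = a m / m%:R]%classic.
have S_inf : has_inf S.
  split; first by exists (a 1%N / 1%:R), 1%N.
  exists kappa => _ [m m0 ->]; rewrite ler_pdivlMr ?ltr0n // mulrC; exact: kapP.
pose nu := inf S.
have nuP m : m%:R * nu <= a m.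
  have [->|m0] := posnP m; first by rewrite mul0r Ed_ge0.
  rewrite mulrC -ler_pdivlMr ?ltr0n //; apply: ge_inf; first by case: S_inf.
  by exists m.
have kapnu : kappa <= nu.
  apply: lb_le_inf; first by case: S_inf.
  move=> _ [m m0 ->]; rewrite ler_pdivlMr ?ltr0n // mulrC; exact: kapP.
have [g g0 gP] := common_gap sP.
(* the error for which the event [badZ] below has probability at most [eta / 4] *)
pose delta := g * eta / 12%:R.
have delta0 : 0 < delta by rewrite divr_gt0 // mulr_gt0.
have [_ [m m0 ->] /ltW] := inf_adherent delta0 S_inf.
rewrite ler_pdivrMr ?ltr0n // -/nu => am.
pose L2 q : R := (2 * norm1 q)%:R ^+ 2.
(* Chebyshev's bounds for [badU] and for all the [badq] add up to at most
   [eta / 2] as soon as [B <= g ^ 2 * eta * N] *)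
pose B := 72%:R * L2 (v *+ m) + 18%:R * \sum_(q <- s) L2 (v + q).
pose N0 := (m * (Num.trunc (B / (g ^+ 2 * eta))).+1)%N.
have N0B N : (0 < N)%N -> (N0 %| N)%N -> B <= g ^+ 2 * eta * N%:R.
  move=> N0' /(dvdn_leq N0') N0N.
  have ge0 : 0 < g ^+ 2 * eta by rewrite mulr_gt0 // exprn_gt0.
  rewrite mulrC -ler_pdivrMr //; apply: le_trans (ltW (truncnS_gt _)) _.
  by rewrite ler_nat; apply: leq_trans N0N; rewrite /N0 leq_pmull.
exists N0; first by rewrite /N0 muln_gt0 m0.
move=> N NN0 N0N n0.
have /dvdnP[K NK] : (m %| N)%N by apply: dvdn_trans N0N; rewrite /N0 dvdn_mulr.
have NR0 : 0 < N%:R :> R by rewrite ltr0n.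
have {}N0B := N0B N NN0 N0N.
(* a time n at which the mean advantage is nearly the asymptotic one *)
have [k [n0k incr]] := @increment_ge (fun k => a (2 * N * k)%N)
  ((2 * N)%:R * nu) ((2 * N)%:R * nu - N%:R * delta)
  ltac:(by rewrite ltrBlDr ltrDl mulr_gt0)
  ltac:(by move=> k; rewrite mulrA -natrM mulnC; exact: nuP) n0.
pose n := (N + 2 * N * k)%N.
exists n; split; first by rewrite /n; nia.
pose x := - (v *+ N); pose z := v *+ n.
pose U b := hops (v *+ m) x (2 * K) b.
have U_end : x + v *+ m *+ (2 * K) = v *+ N.
  rewrite -mulrnA (_ : m * (2 * K) = N + N)%N; last by lia.
  by rewrite mulrnDr addKr.
have Uq_end q : x + (v + q) *+ N = q *+ N by rewrite mulrnDl addKr.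
(* the defect of the advantage of [v *+ N] over [- (v *+ N)] with respect to its
   upper bound [U] *)
pose Z b : R := (U b)%:R - ((distance b x z)%:R - (distance b (v *+ N) z)%:R).
have fD y : finitary (fun b => (distance b y z)%:R : R) by exact: finitary_distanceR.
have fU : finitary (fun b => (U b)%:R : R).
  exact: (finitary_comp (fun n : nat => n%:R)) (finitary_hops _ _ _).
have fDD : finitary (fun b => (distance b x z)%:R - (distance b (v *+ N) z)%:R : R).
  exact: (finitary_comp2 (fun s t : R => s - t)).
have fZ : finitary Z by exact: (finitary_comp2 (fun s t : R => s - t)).
have Z0 b : 0 <= Z b.
  rewrite /Z subr_ge0 lerBlDr -natrD ler_nat.
  apply: leq_trans (distance_triangle _ _ (v *+ N) _) _.
  by rewrite leq_add2r -[X in distance _ _ X]U_end distance_hops.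
have EZ : Ex p Z <= 3%:R * delta * N%:R.
  rewrite /Z ExB // ExB // Ex_hops -/(Ed _ _ _) -/(Ed _ _ _).
  rewrite (Ed_sub _ x) (Ed_sub _ (v *+ N)).
  have -> : z - x = v *+ (2 * N * k.+1).
    by rewrite /z /x opprK -mulrnDr; congr (_ *+ _); rewrite /n; lia.
  have -> : z - v *+ N = v *+ (2 * N * k) by rewrite /z /n mulrnDr addrC addKr.
  rewrite -/(a m) -/(a (2 * N * k.+1)%N) -/(a (2 * N * k)%N).
  have : (2 * K)%:R * a m <= (2 * K)%:R * ((nu + delta) * m%:R) by rewrite ler_wpM2l.
  rewrite (_ : (2 * K)%:R * ((nu + delta) * m%:R) = 2%:R * N%:R * (nu + delta)).
    by move: incr; rewrite natrM; lra.
  by rewrite NK !natrM; ring.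
pose badU b := g * N%:R <= `|(U b)%:R - (2 * K)%:R * Ed p 0 (v *+ m)|.
pose badZ b := g * N%:R <= Z b.
pose badq q b := g * N%:R <= `|(hops (v + q) x N b)%:R - N%:R * Ed p 0 (v + q)|.
have gN0 : 0 < g * N%:R by rewrite mulr_gt0.
have PbadU : Pr p badU <= 18%:R * L2 (v *+ m) / (g ^+ 2 * N%:R).
  apply: le_trans (hops_deviation p0 p1 _ _ _ gN0) _.
  rewrite -/(L2 _) ler_pdivrMr ?exprn_gt0 //.
  rewrite [X in _ <= X](_ : _ = 18%:R * L2 (v *+ m) * N%:R); last first.
    by field; rewrite !gt_eqF.
  rewrite natrM.
  have : K%:R <= N%:R :> R by rewrite ler_nat NK leq_pmulr.
  have : 0 <= L2 (v *+ m) by exact: sqr_ge0.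
  by move=> *; nra.
have Pbadq q : Pr p (badq q) <= 9%:R * L2 (v + q) / (g ^+ 2 * N%:R).
  apply: le_trans (hops_deviation p0 p1 _ _ _ gN0) _.
  rewrite -/(L2 _) ler_pdivrMr ?exprn_gt0 //.
  rewrite [X in _ <= X](_ : _ = 9%:R * L2 (v + q) * N%:R) //.
  by field; rewrite !gt_eqF.
have PbadZ : Pr p badZ <= eta / 4%:R.
  apply: le_trans (Pr_markov p0 p1 _ fZ gN0 Z0 (fun b h => h)) _.
    exact: (finitary_comp (fun t : R => g * N%:R <= t)).
  rewrite ler_pdivrMr //; apply: le_trans EZ _; rewrite /delta; lra.
have fbadU : finitary badU.
  exact: (finitary_comp (fun t : R => g * N%:R <= `|t - (2 * K)%:R * Ed p 0 (v *+ m)|)).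
have fbadZ : finitary badZ by exact: (finitary_comp (fun t : R => g * N%:R <= t)).
have fbadq q : finitary (badq q).
  exact: (finitary_comp (fun t : nat => g * N%:R <= `|t%:R - N%:R * Ed p 0 (v + q)|))
    (finitary_hops _ _ _).
pose win := wins (v *+ N) [seq q *+ N | q <- s] z.
have fwin : finitary win by exact: finitary_wins.
have bad b : ~~ win b -> [|| badU b, badZ b | has (fun q => badq q b) s].
  apply: contraNT; rewrite !negb_or => /and3P[nU nZ /hasPn nq].
  apply/allP => _ /mapP[q qs ->]; rewrite -(ltr_nat R).
  move: (nq q qs) nU nZ; rewrite /badU /badZ /badq -!ltNge !ltr_norml /Z.
  move=> /andP[_ hq] /andP[hU _] hZ.
  have : (distance b x z)%:R <= (hops (v + q) x N b)%:R + (distance b (q *+ N) z)%:R :> R.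
    rewrite -natrD ler_nat -(Uq_end q).
    apply: leq_trans (distance_triangle _ _ (x + (v + q) *+ N) _) _.
    by rewrite leq_add2r distance_hops.
  have h1 : N%:R * Ed p 0 (v + q) <= N%:R * (2%:R * nu - 4%:R * g).
    by rewrite ler_wpM2l //; apply: le_trans (gP q qs) _; lra.
  have h2 : 2%:R * N%:R * nu <= (2 * K)%:R * Ed p 0 (v *+ m).
    have := nuP m; rewrite -/(a m) => /(ler_wpM2l (ler0n R (2 * K))).
    suff -> : (2 * K)%:R * (m%:R * nu) = 2%:R * N%:R * nu by [].
    by rewrite NK !natrM; ring.
  lra.
rewrite -/z -/win.
suff : Pr p (fun b => ~~ win b) <= eta by rewrite PrC //; lra.
pose ind (A : (edge -> bool) -> bool) b : R := (A b)%:R.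
have find A : finitary A -> finitary (ind A) by exact: finitary_Pr.
have fsum : finitary (fun b => \sum_(q <- s) ind (badq q) b).
  by apply: finitary_big => q; exact: find.
apply: (@le_trans _ _ (Ex p (fun b => ind badU b + (ind badZ b +
  \sum_(q <- s) ind (badq q) b)))).
  apply: Ex_le => //.
  - by apply: find; exact: (finitary_comp negb).
  - apply: (finitary_comp2 (fun s t : R => s + t)); first exact: find.
    by apply: (finitary_comp2 (fun s t : R => s + t)) => //; exact: find.
  - move=> b; move: (bad b); have s0 : 0 <= \sum_(q <- s) ind (badq q) b.
      by apply: sumr_ge0 => q _; exact: ler0n.
    have ind0 A : 0 <= ind A b by exact: ler0n.
    have ind1 (A : (edge -> bool) -> bool) : A b -> ind A b = 1 by rewrite /ind => ->.
    case: (win b) => /=; first by move=> _; rewrite !addr_ge0.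
    move=> /(_ isT) /or3P[/ind1 ->|/ind1 ->|/hasP[q qs bq]].
    + by rewrite lerDl addr_ge0.
    + by rewrite addrCA lerDl addr_ge0.
    + rewrite addrA; apply: ler_wpDl; first exact: addr_ge0.
      rewrite (big_rem q) //= ind1 // lerDl.
      by apply: sumr_ge0 => *.
rewrite ExD; [|exact: find|]; last first.
  by apply: (finitary_comp2 (fun s t : R => s + t)) => //; exact: find.
rewrite ExD //; last exact: find.
rewrite Ex_sum; last by move=> q; exact: find.
have : \sum_(q <- s) Ex p (ind (badq q)) <=
    \sum_(q <- s) 9%:R * L2 (v + q) / (g ^+ 2 * N%:R).
  by apply: ler_sum => q _; exact: Pbadq.
rewrite -mulr_suml -mulr_sumr.
have : 18%:R * L2 (v *+ m) / (g ^+ 2 * N%:R) +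
  9%:R * (\sum_(q <- s) L2 (v + q)) / (g ^+ 2 * N%:R) <= eta / 2%:R.
  rewrite -mulrDl ler_pdivrMr ?mulr_gt0 ?exprn_gt0 //.
  have : 0 <= L2 (v *+ m) by exact: sqr_ge0.
  by move: N0B; rewrite /B; lra.
move: PbadU PbadZ; rewrite /Pr -/(ind badU) -/(ind badZ).
by lra.
Qed.

End Advantage.

(** * A lower bound for the speed along the axes *)

Section Polymer.
Implicit Types (b : edge -> bool) (w : int -> nat) (y : int).

Lemma relax_ex w y : exists m, `[< exists y', m = (w y' + absz (y - y')%R)%N >].
Proof. by exists (w y + absz (y - y)%R)%N; apply/asboolP; exists y. Qed.

(** The largest 1-Lipschitz function below [w]; the minimum over [y'] of
    [w y' + |y - y'|] is attained because [w] takes natural values. *)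
Definition relax w y : nat := ex_minn (relax_ex w y).

Lemma relax_le w y y' : (relax w y <= w y' + absz (y - y')%R)%N.
Proof.
rewrite /relax; case: ex_minnP => m _; apply.
by apply/asboolP; exists y'.
Qed.

Lemma relax_attained w y : exists y', relax w y = (w y' + absz (y - y')%R)%N.
Proof. by rewrite /relax; case: ex_minnP => m /asboolP. Qed.

Lemma relax_lipschitz w y y' : (relax w y <= relax w y' + absz (y - y')%R)%N.
Proof.
have [y2 ->] := relax_attained w y'; have := relax_le w y y2; lia.
Qed.

(** The edge from [(n, y)] to [(n + 1, y)]. *)
Definition column_edge (n : nat) y : edge := ((n%:Z, y), false).

(** The least cost of a path from the line of abscissa 0 to the point [(n, y)]
    which never steps to the left, when the vertical edges cost 1. *)
Fixpoint polymer b n y : nat :=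
  if n is n'.+1 then
    relax (fun y' => polymer b n' y' + (b (column_edge n' y')).+1)%N y
  else 0%N.

Lemma polymer_lipschitz b n y y' :
  (polymer b n y <= polymer b n y' + absz (y - y')%R)%N.
Proof. by case: n => // n; exact: relax_lipschitz. Qed.

Lemma polymer_right b n y :
  (polymer b n.+1 y <= polymer b n y + (b (column_edge n y)).+1)%N.
Proof.
by apply: leq_trans (relax_le _ _ y) _; rewrite subrr addn0.
Qed.

Lemma polymer_left b n y : (polymer b n y <= polymer b n.+1 y)%N.
Proof.
have [y' /= ->] := relax_attained
  (fun y' => polymer b n y' + (b (column_edge n y')).+1)%N y.
have := polymer_lipschitz b n y y'; lia.
Qed.

Lemma polymer_le b n y : (polymer b n y <= 2 * n)%N.
Proof.
elim: n => [|n IH] //; apply: leq_trans (polymer_right b n y) _.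
by case: (b _); lia.
Qed.

Lemma polymer_attained b n y : exists y', (absz (y - y')%R <= 2 * n.+1)%N /\
  polymer b n.+1 y =
    (polymer b n y' + (b (column_edge n y')).+1 + absz (y - y')%R)%N.
Proof.
have [y' /= E] := relax_attained
  (fun y' => polymer b n y' + (b (column_edge n y')).+1)%N y.
exists y'; split; last exact: E.
have := polymer_le b n.+1 y; rewrite /= E; lia.
Qed.

(** A function on the lattice which varies along each edge by at most the weight
    of this edge; therefore it bounds passage times from below. *)
Definition potential b (u : Z2) : nat :=
  if u.1 is Posz n then polymer b n u.2 else 0%N.

Lemma potential_edge b e :
  (potential b (edge_tgt e) <= potential b (edge_src e) + (b e).+1)%N /\
  (potential b (edge_src e) <= potential b (edge_tgt e) + (b e).+1)%N.
Proof.
case: e => [[a c] []]; rewrite /edge_src /edge_tgt /potential /=.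
  case: a => // n; set w := (b _).+1; have : (0 < w)%N by [].
  have := polymer_lipschitz b n (c + 1) c; have := polymer_lipschitz b n c (c + 1).
  by split; lia.
case: a => [n|[|n]] //=.
rewrite ?addn1.
split; first exact: polymer_right.
exact: leq_trans (polymer_left _ _ _) (leq_addr _ _).
Qed.

Lemma potential_path b x p : path neighbour x p ->
  (potential b (last x p) <= potential b x + time b x p)%N.
Proof.
rewrite /time; elim: p x => [|y p IH] x /=; first by rewrite big_nil addn0.
move=> /andP[xy /IH]; rewrite big_cons => h; apply: leq_trans h _.
rewrite addnA leq_add2r; have [h1 h2] := potential_edge b (edge_of x y).
by case: (ends_edge_of xy) h1 h2 => -[-> ->].
Qed.

Lemma polymer_distance b n y y0 : (polymer b n y <= distance b (0%R, y0) (n%:Z, y))%N.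
Proof.
have [p [px py <-]] := geodesic b (0, y0) (n%:Z, y).
by have := potential_path b px; rewrite py.
Qed.

Lemma polymer_columns n y :
  depends_on (fun e : edge => e.1.1 < n%:Z) (fun b => polymer b n y).
Proof.
elim: n y => [|n IH] y b b' bb' //=; congr relax; apply/funext => y'.
rewrite (IH _ b b'); first by rewrite bb' //=; lia.
by move=> e en; apply: bb'; lia.
Qed.

Lemma polymer_near n y :
  depends_on (edge_near (0, y) (3 * n ^ 2)) (fun b => polymer b n y).
Proof.
elim: n y => [|n IH] y //.
have H b b' : (forall e, edge_near (0, y) (3 * n.+1 ^ 2) e -> b e = b' e) ->
    (polymer b n.+1 y <= polymer b' n.+1 y)%N.
  move=> bb'; have [y' [yy' ->]] := polymer_attained b' n y.
  rewrite -(IH y' b b'); last first.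
    by move=> e; rewrite /edge_near /l1 /= => h; apply: bb'; rewrite /edge_near /l1 /=; nia.
  rewrite -bb'; last by rewrite /edge_near /l1 /=; nia.
  exact: relax_le.
by move=> b b' bb'; apply/eqP; rewrite eqn_leq !H // => e /bb' ->.
Qed.

Lemma finitary_polymer n y : finitary (fun b => polymer b n y).
Proof. exact: finitary_near (@polymer_near n y). Qed.

Variables (R : realFieldType) (p q : R).
Hypotheses (p0 : 0 <= p) (p1 : p <= 1) (q0 : 0 < q) (q2 : q <= 1 / 2%:R).

Let q1 : q < 1. Proof. by move: q2; lra. Qed.

(** The mean of [q ^ w] for an edge of weight [w]. *)
Definition edge_laplace : R := p * q ^+ 2 + (1 - p) * q.

(** The factor lost by the partition function at each column: the entry edge, and
    the vertical move, whose length has the generating function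
    [(1 + q) / (1 - q)]. *)
Definition polymer_rate : R := edge_laplace * ((1 + q) / (1 - q)).

Let edge_laplace_ge0 : 0 <= edge_laplace.
Proof. by rewrite /edge_laplace addr_ge0 ?mulr_ge0 ?exprn_ge0 ?subr_ge0 ?(ltW q0). Qed.

Let polymer_rate_ge0 : 0 <= polymer_rate.
Proof.
rewrite mulr_ge0 ?edge_laplace_ge0 // divr_ge0 ?subr_ge0 ?(ltW q1) //.
by rewrite addr_ge0 ?(ltW q0).
Qed.

Let geometric n : \sum_(k < n) q ^+ k <= (1 - q)^-1.
Proof.
have q1' : 0 < 1 - q by rewrite subr_gt0.
have q1n : 1 - q != 0 by rewrite gt_eqF.
rewrite -[X in X <= _](mulfK q1n) ler_pdivrMr // mulVf //.
have -> : (\sum_(k < n) q ^+ k) * (1 - q) = 1 - q ^+ n.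
  elim: n => [|n IH]; first by rewrite big_ord0 expr0; ring.
  by rewrite big_ord_recr /= mulrDl IH exprS; ring.
by rewrite gerBl exprn_ge0 // ltW.
Qed.

(** First moment bound, by induction on the columns: the polymer up to column [n]
    is independent of the next horizontal edges. *)
Lemma Ex_polymer n y : Ex p (fun b => q ^+ polymer b n y) <= polymer_rate ^+ n.
Proof.
have q0' := ltW q0.
elim: n y => [|n IH] y; first by rewrite expr0 Ex_cst.
pose T y' b : R := q ^+ (b (column_edge n y')).+1 * q ^+ polymer b n y'.
have fe y' : finitary (fun b : edge -> bool => q ^+ (b (column_edge n y')).+1 : R).
  exact: (finitary_comp (fun c : bool => q ^+ c.+1)) (finitary_coord _).
have fp m y' : finitary (fun b => q ^+ polymer b m y' : R).
  exact: (finitary_comp (fun k => q ^+ k)) (finitary_polymer _ _).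
have fT y' : finitary (T y') by exact: (finitary_comp2 (fun s t : R => s * t)).
have T0 y' b : 0 <= T y' b by rewrite mulr_ge0 ?exprn_ge0.
have ET y' : Ex p (T y') <= edge_laplace * polymer_rate ^+ n.
  rewrite (@Ex_indep R _ p (pred1 (column_edge n y')) (fun e : edge => e.1.1 < n%:Z) _ _
    (fe y') (fp n y')).
  - rewrite (Ex_coord p _ (fun c : bool => q ^+ c.+1)) /= expr1 -/edge_laplace.
    by rewrite ler_wpM2l ?edge_laplace_ge0.
  - by move=> b b' bb'; rewrite bb' //= eqxx.
  - by move=> b b' bb'; rewrite (polymer_columns y' bb').
  - by move=> e /eqP -> /=; rewrite ltxx.
pose m := (2 * n.+1).+1.
have fs (h : nat -> R) (r : nat -> int) :
    finitary (fun b => \sum_(k < m) h k * T (r k) b).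
  by apply: finitary_big => k; exact: (finitary_comp (fun t => h k * t)).
apply: (@le_trans _ _ (Ex p (fun b =>
    \sum_(k < m) q ^+ k * T (y + k%:Z) b + \sum_(k < m) q ^+ k.+1 * T (y - k.+1%:Z) b))).
  apply: Ex_le => //.
    apply: (finitary_comp2 (fun s t : R => s + t)).
      exact: (fs (fun k => q ^+ k) (fun k => y + k%:Z)).
    exact: (fs (fun k => q ^+ k.+1) (fun k => y - k.+1%:Z)).
  move=> b; have [y' [yy' ->]] := polymer_attained b n y.
  rewrite !exprD [X in X * _]mulrC -/(T y' b).
  have pos1 : 0 <= \sum_(k < m) q ^+ k * T (y + k%:Z) b.
    by apply: sumr_ge0 => k _; rewrite mulr_ge0 ?exprn_ge0.
  have pos2 : 0 <= \sum_(k < m) q ^+ k.+1 * T (y - k.+1%:Z) b.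
    by apply: sumr_ge0 => k _; rewrite mulr_ge0 ?exprn_ge0.
  have [yy|yy] := leP y y'.
  (* the column is entered above or below [y] *)
  - have km : (absz (y - y')%R < m)%N by rewrite /m; lia.
    apply: ler_wpDr => //; rewrite (bigD1 (Ordinal km)) //= mulrC.
    have -> : T (y + (absz (y - y')%R)%:Z) b = T y' b by congr (T _ b); lia.
    by rewrite lerDl; apply: sumr_ge0 => k _; rewrite mulr_ge0 ?exprn_ge0.
  - have km : ((absz (y - y')%R).-1 < m)%N by rewrite /m; lia.
    apply: ler_wpDl => //; rewrite (bigD1 (Ordinal km)) //= mulrC.
    have -> : T (y - (absz (y - y')%R).-1.+1%:Z) b = T y' b by congr (T _ b); lia.
    have -> : q ^+ (absz (y - y')%R).-1.+1 = q ^+ absz (y - y')%R.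
      by congr (q ^+ _); lia.
    by rewrite lerDl; apply: sumr_ge0 => k _; rewrite mulr_ge0 ?exprn_ge0.
have Es (h : nat -> R) (r : nat -> int) : (forall k, 0 <= h k) ->
    Ex p (fun b => \sum_(k < m) h k * T (r k) b) <=
    \sum_(k < m) h k * (edge_laplace * polymer_rate ^+ n).
  move=> h0; rewrite (@Ex_sum R _ p _ _ (fun (k : 'I_m) b => h k * T (r k) b)).
    by apply: ler_sum => k _; rewrite ExZ // ler_wpM2l.
  by move=> k; exact: (finitary_comp (fun t : R => h k * t)).
rewrite ExD; last 2 first.
- exact: (fs (fun k => q ^+ k) (fun k => y + k%:Z)).
- exact: (fs (fun k => q ^+ k.+1) (fun k => y - k.+1%:Z)).
apply: (le_trans (lerD (Es (fun k => q ^+ k) (fun k => y + k%:Z) _)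
  (Es (fun k => q ^+ k.+1) (fun k => y - k.+1%:Z) _))).
- by move=> k; exact: exprn_ge0.
- by move=> k; exact: exprn_ge0.
rewrite /=.
under [X in _ + X]eq_bigr => k _ do rewrite exprS -mulrA.
rewrite -mulr_sumr -mulr_suml exprS {2}/polymer_rate.
have := geometric m; set s := \sum_(k < m) _.
have rn : 0 <= edge_laplace * polymer_rate ^+ n.
  by rewrite mulr_ge0 ?edge_laplace_ge0 // exprn_ge0 // polymer_rate_ge0.
move: rn; set r := edge_laplace * polymer_rate ^+ n => rn sle.
have -> : edge_laplace * ((1 + q) / (1 - q)) * polymer_rate ^+ n =
   (1 + q) * (1 - q)^-1 * r by rewrite /r; ring.
rewrite -[X in _ <= X]mulrA.
have : s * r <= (1 - q)^-1 * r by rewrite ler_wpM2r.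
nra.
Qed.

Let bernoulli j : q ^+ j * (1 + j%:R) <= 1.
Proof.
elim: j => [|j IH]; first by rewrite expr0 addr0 mul1r.
rewrite exprS -natr1; have : 0 <= q ^+ j by rewrite exprn_ge0 // ltW.
have : 0 <= j%:R :> R by []; move: IH; set t := q ^+ j; set k := j%:R.
move=> h k0 t0; have : 0 <= t * k by exact: mulr_ge0.
move: q2 q0; nra.
Qed.

(** The speed along the axes is at least [1 + 1 / K].  The first moment bound is
    turned into a bound of the mean by [q ^ w >= q ^ m * (1 + m - w)]. *)
Lemma polymer_speed (K : nat) : polymer_rate ^+ K <= q ^+ K.+1 ->
  forall n, K.+1%:R * n%:R <= K%:R * Ed p 0 (n%:Z, 0).
Proof.
move=> hK n; set m := (K.+1 * n)%N.
have q0' := ltW q0.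
(* for abscissa [K * n] no constant is lost *)
have mean : m%:R <= Ed p 0 ((K * n)%:Z, 0).
  apply: (@le_trans _ _ (Ex p (fun b => (polymer b (K * n) 0)%:R))); last first.
    apply: Ex_le => //.
    - exact: (finitary_comp (fun k : nat => k%:R)) (finitary_polymer _ _).
    - exact: finitary_distanceR.
    - by move=> b; rewrite ler_nat polymer_distance.
  have fp : finitary (fun b => (polymer b (K * n) 0)%:R : R).
    exact: (finitary_comp (fun k : nat => k%:R)) (finitary_polymer _ _).
  have qm : 0 < q ^+ m by rewrite exprn_gt0.
  have H : Ex p (fun b => q ^+ m * ((1 + m%:R) - (polymer b (K * n) 0)%:R)) <= q ^+ m * 1.
    rewrite mulr1; apply: le_trans (_ : Ex p (fun b => q ^+ polymer b (K * n) 0) <= _).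
      apply: Ex_le => //.
      + exact: (finitary_comp (fun t : R => q ^+ m * (1 + m%:R - t))).
      + exact: (finitary_comp (fun k => q ^+ k)) (finitary_polymer _ _).
      + move=> b; set w := polymer _ _ _; have [wm|mw] := leqP w m.
          have := bernoulli (m - w); rewrite natrB // addrA => h.
          rewrite -[in q ^+ m](subnK wm) exprD mulrAC -[X in _ <= X]mul1r.
          by rewrite ler_wpM2r ?exprn_ge0.
        apply: (@le_trans _ _ 0); last by rewrite exprn_ge0.
        rewrite mulr_ge0_le0 ?(ltW qm) // subr_le0.
        by rewrite addrC natr1 ler_nat.
    apply: le_trans (Ex_polymer _ _) _; rewrite exprM /m exprM.
    apply: lerXn2r => //; rewrite nnegrE ?exprn_ge0 //.
  have fmp : finitary (fun b => (1 + m%:R) - (polymer b (K * n) 0)%:R : R).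
    exact: (finitary_comp (fun t : R => 1 + m%:R - t)).
  move: H; rewrite ExZ // ler_pM2l // ExB //; last exact: finitary_cst.
  rewrite (@Ex_cst R edge p); lra.
rewrite -natrM; apply: le_trans mean _.
rewrite (_ : ((K * n)%:Z, 0) = ((n%:Z, 0) : Z2) *+ K) ?Ed_mul //.
by rewrite Z2_mulrn /= mul0rn -mulr_natl natz PoszM.
Qed.

End Polymer.

(** * Eight points *)

Section Points.
Variables (R : realType) (p : R).
Hypotheses (p0 : 0 <= p) (p1 : p <= 1).

Lemma Ed_flip (x y : int) : Ed p 0 (x, y) = Ed p 0 (- x, y).
Proof.
pose g (u : Z2) : Z2 := (- u.1, u.2).
have gK : cancel g g by case=> a b; rewrite /g /= opprK.
have gl u v : l1 (g u) (g v) = l1 u v by rewrite /l1 /g /=; lia.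
by rewrite -(Ed_image p 0 (x, y) gK gK gl) /g /= oppr0.
Qed.

Lemma Ed_swap (x y : int) : Ed p 0 (x, y) = Ed p 0 (y, x).
Proof.
pose g (u : Z2) : Z2 := (u.2, u.1).
have gK : cancel g g by case=> a b.
have gl u v : l1 (g u) (g v) = l1 u v by rewrite /l1 /g /=; lia.
by rewrite -(Ed_image p 0 (x, y) gK gK gl).
Qed.

(** Mean passage times from the origin are invariant under the symmetries of the
    square. *)
Lemma Ed_abs (x y : int) : Ed p 0 (x, y) = Ed p 0 ((absz x)%:Z, (absz y)%:Z).
Proof.
have H a b : Ed p 0 (a, b) = Ed p 0 ((absz a)%:Z, b).
  have [a0|a0] := leP 0 a; first by rewrite gez0_abs.
  by rewrite ltz0_abs // -Ed_flip.
by rewrite H Ed_swap H Ed_swap.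
Qed.

Lemma Ed_11 : Ed p 0 (1, 1) <= 2%:R + (2%:R * p) ^+ 2.
Proof.
apply: (Ed_two_paths p0 p1 (q := [:: (1, 0); (1, 1)]) (q' := [:: (0, 1); (1, 1)])) => //.
exact/allP.
Qed.

Lemma Ed_21 : Ed p 0 (2, 1) <= 3%:R + (3%:R * p) ^+ 2.
Proof.
apply: (Ed_two_paths p0 p1 (q := [:: (1, 0); (2, 0); (2, 1)])
  (q' := [:: (0, 1); (1, 1); (2, 1)])) => //.
exact/allP.
Qed.

Lemma Ed_31 : Ed p 0 (3, 1) <= 4%:R + (4%:R * p) ^+ 2.
Proof.
apply: (Ed_two_paths p0 p1 (q := [:: (1, 0); (2, 0); (3, 0); (3, 1)])
  (q' := [:: (0, 1); (1, 1); (2, 1); (3, 1)])) => //.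
exact/allP.
Qed.

Variables (N M K : nat) (kappa : R).
Hypotheses (MN : (M.+1 = 2 * N)%N).

(** Four points on the axes and four on the diagonals. *)
Definition corners : seq Z2 :=
  [:: (M%:Z, 0); (- M%:Z, 0); (0, M%:Z); (0, - M%:Z);
      (N%:Z, N%:Z); (N%:Z, - N%:Z); (- N%:Z, N%:Z); (- N%:Z, - N%:Z)].

Lemma cornersP (a b : int) : (a, b) \in corners ->
  [\/ absz a = M /\ b = 0, a = 0 /\ absz b = M | absz a = N /\ absz b = N].
Proof.
rewrite !inE; case/orP => [/eqP[-> ->]|]; first exact: Or31.
case/orP => [/eqP[-> ->]|]; first by rewrite abszN; exact: Or31.
case/orP => [/eqP[-> ->]|]; first exact: Or32.
case/orP => [/eqP[-> ->]|]; first by rewrite abszN; exact: Or32.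
by case/or4P => /eqP[-> ->]; rewrite ?abszN; exact: Or33.
Qed.

(** Up to symmetry the sum of two distinct corners is short, or [(M, M)], or
    [(M + N, N)]. *)
Lemma corners_sum (v q : Z2) : v \in corners -> q \in corners -> v != q ->
  [\/ (norm1 (v + q)%R <= 2 * N)%N,
      absz (v + q).1 = M /\ absz (v + q).2 = M,
      absz (v + q).1 = (M + N)%N /\ absz (v + q).2 = N |
      absz (v + q).1 = N /\ absz (v + q).2 = (M + N)%N].
Proof.
case: v q => [a b] [c d] /cornersP hv /cornersP hq vq.
have {}vq : a <> c \/ b <> d.
  by apply/not_andP => -[ac bd]; move: vq; rewrite ac bd eqxx.
have normE : norm1 (((a, b) : Z2) + (c, d)) = (absz (a + c)%R + absz (b + d)%R)%N.
  by rewrite /norm1 /l1 /= !sub0r !abszN.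
have add (m n : nat) (x y : int) : absz x = m -> absz y = n -> (n <= m)%N ->
    absz (x + y) = (m + n)%N \/ absz (x + y) = (m - n)%N by lia.
have opp (n : nat) (x y : int) : absz x = n -> absz y = n -> x = y \/ x + y = 0 by lia.
have NM : (N <= M)%N by lia.
rewrite normE /=.
case: hv => -[ha hb]; case: hq => -[hc hd].
- apply: Or41; rewrite hb hd; case: (opp _ _ _ ha hc) => [ac|->]; last by lia.
  by case: vq; rewrite ?hb ?hd.
- by apply: Or42; rewrite hb hc addr0 add0r.
- rewrite hb add0r hd; case: (add _ _ _ _ ha hc NM) => ->; last by apply: Or41; lia.
  exact: Or43.
- by apply: Or42; rewrite ha hd addr0 add0r.
- apply: Or41; rewrite ha hc; case: (opp _ _ _ hb hd) => [bd|->]; last by lia.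
  by case: vq; rewrite ?ha ?hc.
- rewrite ha add0r hc; case: (add _ _ _ _ hb hd NM) => ->; last by apply: Or41; lia.
  exact: Or44.
- rewrite hd addr0 hb addrC; case: (add _ _ _ _ hc ha NM) => ->; last by apply: Or41; lia.
  exact: Or43.
- rewrite hc addr0 ha [b + d]addrC; case: (add _ _ _ _ hd hb NM) => ->; last by apply: Or41; lia.
  exact: Or44.
- apply: Or41; case: (opp _ _ _ ha hc) => [ac|->]; last by lia.
  case: (opp _ _ _ hb hd) => [bd|->]; last by lia.
  by case: vq.
Qed.

Hypotheses (K0 : (0 < K)%N)
  (speed : forall n, K.+1%:R * n%:R <= K%:R * Ed p 0 (n%:Z, 0))
  (kappaM : K%:R * kappa <= K.+1%:R * M%:R) (kappaN : kappa <= 2%:R * N%:R)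
  (gap1 : (1 + p) * (2%:R * N%:R) < 2%:R * kappa)
  (gap2 : M%:R * (2%:R + (2%:R * p) ^+ 2) < 2%:R * kappa)
  (gap3 : (N%:R - 1) * (4%:R + (4%:R * p) ^+ 2) + (3%:R + (3%:R * p) ^+ 2) < 2%:R * kappa).

(** The upper bound required by [wins_likely]. *)
Lemma corners_close v q : v \in corners -> q \in corners -> v != q ->
  Ed p 0 (v + q) < 2%:R * kappa.
Proof.
have N0 : (0 < N)%N by lia.
have far : Ed p 0 ((M + N)%N%:Z, N%:Z) < 2%:R * kappa.
  apply: le_lt_trans gap3.
  (* this uses M + N = 3 (N - 1) + 2 *)
  rewrite (_ : (_, _) = ((3, 1) : Z2) *+ N.-1 + (2, 1)); last first.
    by rewrite Z2_mulrn; congr (_, _); rewrite /=; lia.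
  apply: le_trans (Ed_add p0 p1 _ _) _; apply: lerD Ed_21.
  apply: le_trans (Ed_mul p0 p1 _ _) _.
  rewrite (_ : N%:R - 1 = N.-1%:R); last by rewrite -[in LHS](prednK N0) -natr1 addrK.
  by rewrite ler_wpM2l // Ed_31.
move=> vc qc vq; have := corners_sum vc qc vq; case: (v + q) => [a b] /=.
rewrite Ed_abs; case.
- move=> h; apply: le_lt_trans (Ed_le p0 p1 _ _) _; apply: le_lt_trans gap1.
  rewrite ler_wpM2l ?addr_ge0 // -natrM ler_nat.
  suff <- : norm1 ((a, b) : Z2) = l1 0 ((absz a)%:Z, (absz b)%:Z) by [].
  by rewrite /norm1 /l1 /= !sub0r !abszN.
- move=> [-> ->]; apply: le_lt_trans gap2.
  rewrite (_ : (_, _) = ((1, 1) : Z2) *+ M); last by rewrite Z2_mulrn /= natz.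
  apply: le_trans (Ed_mul p0 p1 _ _) _.
  by rewrite ler_wpM2l // Ed_11.
- by move=> [-> ->].
- by move=> [-> ->]; rewrite Ed_swap.
Qed.

(** The lower bound required by [wins_likely]. *)
Lemma corners_far v m : v \in corners -> m%:R * kappa <= Ed p 0 (v *+ m).
Proof.
have KR : 0 < K%:R :> R by rewrite ltr0n.
have axis : m%:R * kappa <= Ed p 0 ((M * m)%N%:Z, 0).
  rewrite -(ler_pM2l KR); apply: le_trans (speed _).
  rewrite mulrCA natrM [X in _ <= X](_ : _ = m%:R * (K.+1%:R * M%:R)); last by ring.
  by rewrite ler_wpM2l.
have diag : m%:R * kappa <= (2 * (N * m))%:R.
  rewrite !natrM [X in _ <= X](_ : _ = m%:R * (2%:R * N%:R)); last by ring.
  by rewrite ler_wpM2l.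
case: v => [a b] /cornersP vc.
rewrite Z2_mulrn Ed_abs /= -(mulr_natr a) -(mulr_natr b) !abszM !natz /=.
case: vc => -[ha hb].
- by rewrite ha hb mul0n.
- by rewrite ha hb mul0n Ed_swap.
- apply: le_trans diag _; apply: le_trans (Ed_ge p0 p1 _ _).
  by rewrite ler_nat /l1 /= !sub0r !abszN ha hb /= mul2n addnn.
Qed.

(** All the points of a large dilate of [corners] have, each in its own
    direction, the likely advantage of [wins_likely]. *)
Lemma corners_win (eta : R) : 0 < eta ->
  exists2 L, (0 < L)%N & forall v, v \in corners -> forall n0, exists n, (n0 <= n)%N /\
    1 - eta <= Pr p (wins (v *+ L) [seq q *+ L | q <- corners & q != v] (v *+ n)).
Proof.
move=> eta0.
suff [L L0 HL] : exists2 L, (0 < L)%N & forall v, v \in corners ->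
    forall L', (0 < L')%N -> (L %| L')%N -> forall n0, exists n, (n0 <= n)%N /\
    1 - eta <= Pr p (wins (v *+ L') [seq q *+ L' | q <- corners & q != v] (v *+ n)).
  by exists L => // v vc; apply: HL.
have one v : v \in corners -> exists2 L, (0 < L)%N &
    forall L', (0 < L')%N -> (L %| L')%N -> forall n0, exists n, (n0 <= n)%N /\
    1 - eta <= Pr p (wins (v *+ L') [seq q *+ L' | q <- corners & q != v] (v *+ n)).
  move=> vc; apply: (wins_likely p0 p1 (kappa := kappa)) => //.
  - by move=> m _; exact: corners_far.
  - by move=> q; rewrite mem_filter => /andP[qv qc]; apply: corners_close; rewrite // eq_sym.
have H (s : seq Z2) : {subset s <= corners} -> exists2 L, (0 < L)%N & forall v, v \in s ->
    forall L', (0 < L')%N -> (L %| L')%N -> forall n0, exists n, (n0 <= n)%N /\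
    1 - eta <= Pr p (wins (v *+ L') [seq q *+ L' | q <- corners & q != v] (v *+ n)).
  elim: s => [|v s IH] sc; first by exists 1%N.
  have [|L L0 HL] := IH; first by move=> u us; apply: sc; rewrite inE us orbT.
  have [|L1 L10 HL1] := one v; first by apply: sc; rewrite inE eqxx.
  (* the conclusion for [v] holds for all the multiples of [L1] *)
  exists (L * L1)%N; first by rewrite muln_gt0 L0.
  move=> u; rewrite inE => /orP[/eqP ->|us] L' L'0 LL'.
    by apply: HL1 => //; apply: dvdn_trans LL'; exact: dvdn_mull.
  by apply: HL => //; apply: dvdn_trans LL'; exact: dvdn_mulr.
exact: H.
Qed.

End Points.

Section Constants.
Variable R : realType.

Lemma bernoulli_ge (x : R) n : 0 <= x -> 1 + n%:R * x <= (1 + x) ^+ n.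
Proof.
move=> x0; elim: n => [|n IH]; first by rewrite expr0 mul0r addr0.
rewrite exprS -natr1; have : 0 <= n%:R * x ^+ 2 by rewrite mulr_ge0 ?exprn_ge0.
move: IH; set t := (1 + x) ^+ n; set k := n%:R; nra.
Qed.

Let p : R := 1 / 10%:R ^+ 3.
(* The fugacity: at this value the entropy [2 q] of the vertical moves is half of
   the gain [p] due to the edges of weight 2. *)
Let q : R := 1 / (4%:R * 10%:R ^+ 3).

(** The speed along the axes is at least [1 + 1 / 26000]: with
    [polymer_rate p q = q * r] and [r <= 1 / (1 + 1 / 2000)], one has
    [r ^ 26000 <= 2 ^ (- 13) <= q].  The number 2000 is a variable [k] so that
    it is never expanded in unary. *)
Lemma rate_small (k : nat) : k%:R = (2%:R * 10%:R ^+ 3) :> R ->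
  polymer_rate p q ^+ (k * 13) <= q ^+ (k * 13).+1.
Proof.
move=> kE; set K := (k * 13)%N.
pose r : R := (1 - p + p * q) * (1 + q) / (1 - q).
have q1' : 0 < 1 - q by rewrite /q; lra.
have q1 : 1 - q != 0 by rewrite gt_eqF.
have -> : polymer_rate p q = q * r.
  by rewrite /polymer_rate /edge_laplace /r; field.
have q0 : 0 <= q by rewrite /q; lra.
have r0 : 0 <= r by rewrite /r divr_ge0 ?(ltW q1') //; rewrite /p /q; lra.
rewrite exprMn exprSr ler_wpM2l ?exprn_ge0 //.
pose x : R := 1 / (2%:R * 10%:R ^+ 3).
have x0 : 0 <= x by rewrite /x; lra.
have rx : r * (1 + x) <= 1.
  by rewrite /r mulrAC ler_pdivrMr // /p /q /x; lra.
have x2 : 2%:R <= (1 + x) ^+ k.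
  apply: le_trans (bernoulli_ge k x0); rewrite kE /x; lra.
have xK : (4%:R * 10%:R ^+ 3) <= (1 + x) ^+ K.
  rewrite /K exprM; apply: (@le_trans _ _ (2%:R ^+ 13)); first lra.
  by apply: lerXn2r => //; rewrite nnegrE ?exprn_ge0 ?addr_ge0.
have rxK : r ^+ K * (1 + x) ^+ K <= 1.
  by rewrite -exprMn exprn_ile1 // mulr_ge0 // addr_ge0.
have rK0 : 0 <= r ^+ K by rewrite exprn_ge0.
have : r ^+ K * (4%:R * 10%:R ^+ 3) <= 1 by apply: le_trans rxK; rewrite ler_wpM2l.
rewrite /q; lra.
Qed.

(** Eight points each of which is, with high probability, the closest one to
    infinitely many sites taken one at a time. *)
Lemma advantage (eta : R) : 0 < eta -> exists s : seq Z2, [/\ size s = 8, uniq s &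
  forall x, x \in s -> exists2 z : nat -> Z2, injective z &
    forall n0, exists n, (n0 <= n)%N /\
      1 - eta <= Pr p (wins x [seq y <- s | y != x] (z n))].
Proof.
move=> eta0.
have p0 : 0 <= p by rewrite /p; lra.
have p1 : p <= 1 by rewrite /p; lra.
have [N NE] : exists N : nat, N%:R = 10%:R ^+ 4 :> R by exists (100 * 100)%N; rewrite natrM; lra.
have [k kE] : exists k : nat, k%:R = (2%:R * 10%:R ^+ 3) :> R
  by exists (20 * 100)%N; rewrite natrM; lra.
pose M := (2 * N).-1.
have N0 : (0 < N)%N by rewrite -(ltr_nat R) NE; lra.
have MN : (M.+1 = 2 * N)%N by rewrite prednK // muln_gt0.
have ME : M%:R = 2%:R * 10%:R ^+ 4 - 1 :> R.
  have : M.+1%:R = 2%:R * N%:R :> R by rewrite MN natrM.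
  by rewrite -natr1 NE; lra.
have KE : (k * 13)%:R = 26%:R * 10%:R ^+ 3 :> R by rewrite natrM kE; lra.
have q0 : 0 < q by rewrite /q; lra.
have q2 : q <= 1 / 2%:R by rewrite /q; lra.
have sp := polymer_speed p0 p1 q0 q2 (rate_small kE).
move: sp KE; move: (k * 13)%N => K sp KE.
have K0 : (0 < K)%N by rewrite -(ltr_nat R) KE; lra.
pose kappa : R := (26%:R * 10%:R ^+ 3 + 1) / (26%:R * 10%:R ^+ 3) * (2%:R * 10%:R ^+ 4 - 1).
have KS : K.+1%:R = 26%:R * 10%:R ^+ 3 + 1 :> R by rewrite -natr1 KE; lra.
clearbody M.
have [|||||L L0 HL] := @corners_win R p p0 p1 N M K kappa MN K0 sp _ _ _ _ _ eta eta0.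
- by rewrite KE KS ME /kappa; lra.
- by rewrite NE /kappa; lra.
- by rewrite NE /kappa /p; lra.
- by rewrite ME /kappa /p; lra.
- by rewrite NE /kappa /p; lra.
have dil_inj : injective (fun v : Z2 => v *+ L).
  move=> [a b] [c d]; rewrite !Z2_mulrn /= => -[].
  by move=> /(pmulrnI L0) -> /(pmulrnI L0) ->.
exists [seq v *+ L | v <- corners N M]; split.
- by rewrite size_map.
- rewrite map_inj_uniq // /corners /= !inE !negb_or -!pair_eqE /=.
  by repeat (apply/andP; split); lia.
- move=> _ /mapP[v vc ->]; exists (fun n => v *+ n); last first.
    move=> n0; have [n [n0n h]] := HL v vc n0; exists n; split => //.
    move: h; congr (_ <= Pr p (wins _ _ _)).
    by rewrite filter_map; congr map; apply: eq_filter => q' /=;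
      have /= -> := inj_eq dil_inj q' v.
  have v0 : (0 < norm1 v)%N.
    case: v vc => [a b] /cornersP; rewrite /norm1 /l1 /= !sub0r !abszN.
    have M0 : (0 < M)%N by lia.
    by case=> -[-> ->]; lia.
  move=> m n /(congr1 norm1); rewrite !l1_mul => /eqP.
  by rewrite eqn_pmul2r ?muln_gt0 ?L0 // => /eqP.
Qed.

End Constants.

(** * Independent coins on the unit interval *)

Local Open Scope classical_set_scope.
Local Open Scope ring_scope.

Section FinitaryEvents.
Context d (T : measurableType d) (R : realType) (I : eqType).
Variables (D : T -> I -> bool).
Hypothesis mD : forall e, measurable [set x | D x e].

Lemma measurable_finitary (F : (I -> bool) -> bool) :
  finitary F -> measurable [set x | F (D x)].
Proof.
move=> [s]; elim: s F => [|e s IH] F Fs.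
  have [F0|F0] := boolP (F xpred0).
    rewrite (_ : [set x | F (D x)] = setT) //.
    by apply/seteqP; split => // x _ /=; rewrite (Fs _ xpred0).
  rewrite (_ : [set x | F (D x)] = set0) //.
  apply/seteqP; split => // x /=; rewrite (Fs _ xpred0) //.
  by rewrite (negbTE F0).
have H c : measurable [set x | F (update (D x) e c)].
  apply: (IH (fun b => F (update b e c))) => b b' bb'; apply: Fs => k.
  by rewrite /= inE /update; case: eqP => //= _; exact: bb'.
rewrite (_ : [set x | F (D x)] =
    ([set x | D x e] `&` [set x | F (update (D x) e true)]) `|`
    (~` [set x | D x e] `&` [set x | F (update (D x) e false)])).
  apply: measurableU; apply: measurableI; [exact: mD|exact: H| |exact: H].
  exact: measurableC (mD e).
have upd x : update (D x) e (D x e) = D x.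
  by apply/funext => k; rewrite /update; case: eqP => [->|].
apply/seteqP; split => x /= Fx.
  have {}Fx : F (update (D x) e (D x e)) by rewrite upd.
  by case: (D x e) Fx => Fx; [left|right].
by rewrite -(upd x); case: (D x e) Fx => -[[h Fx]|[h Fx]].
Qed.

Variables (P : probability T R) (p : R).

(** The probability that a coin shows [c]. *)
Definition coin_weight (c : bool) : R := if c then p else 1 - p.

(** The map [D] has the law of independent coins on finitary events.  It suffices
    that the law of the coins in a finite set [r] be known on the
    elementary events of [r]. *)
Lemma probability_finitary (r : seq I) (F : (I -> bool) -> bool) :
  uniq r -> depends_on (mem r) F ->
  (forall c : I -> bool, P [set x | forall k, k \in r -> D x k = c k] =
     (\prod_(k <- r) coin_weight (c k))%:E) ->
  P [set x | F (D x)] = (Pr p F)%:E.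
Proof.
move=> ur Fr Pr_r; pose f b : R := (F b)%:R.
pose A (t : seq I) (c : I -> bool) := [set x | (forall k, k \in t -> D x k = c k) /\ F (D x)].
have fin_t t c : finitary (fun b : I -> bool => all (fun k => b k == c k) t && F b).
  apply: (finitary_comp2 andb); last by exists r.
  elim: t => [|e t IH]; first exact: finitary_cst.
  exact: (finitary_comp2 andb (finitary_comp (fun x => x == c e) (finitary_coord e)) IH).
have AE t c : A t c = [set x | all (fun k => D x k == c k) t && F (D x)].
  apply/seteqP; split => x /= [].
    by move=> h Fx; rewrite Fx andbT; apply/allP => k /h ->.
  by move=> /andP[/allP h Fx]; split => // k /h /eqP.
have mA t c : measurable (A t c) by rewrite AE; exact: (measurable_finitary (fin_t t c)).
have claim s t c : perm_eq (t ++ s) r ->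
    P (A t c) = ((\prod_(k <- t) coin_weight (c k)) * resamples p s f c)%:E.
  elim: s t c => [|e s IH] t c.
    rewrite cats0 => tr; rewrite /= /f.
    have tr' k : (k \in t) = (k \in r) by exact: perm_mem.
    have FD x : (forall k, k \in t -> D x k = c k) -> F (D x) = F c.
      by move=> h; apply: Fr => k /=; rewrite -tr'; exact: h.
    case: (boolP (F c)) => Fc.
      rewrite mulr1 (perm_big _ tr) -Pr_r; congr (P _); apply/seteqP; split => x /=.
        by move=> [h _] k; rewrite -tr'; exact: h.
      move=> h; have h' k : k \in t -> D x k = c k by rewrite tr'; exact: h.
      by split => //; rewrite FD.
    rewrite mulr0 (_ : A t c = set0) ?measure0 //; apply/seteqP; split => // x [h].
    by rewrite FD // (negbTE Fc).
  move=> tes.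
  have et : e \notin t.
    have : uniq (t ++ e :: s) by rewrite (perm_uniq tes).
    by rewrite cat_uniq => /and3P[_ /hasPn /(_ e)]; rewrite inE eqxx => /(_ isT).
  have tes' : perm_eq ((e :: t) ++ s) r.
    by apply: perm_trans tes; rewrite -(cat1s e s) /= -(cat1s e (t ++ s)) perm_catCA.
  have upd c' k : k \in t -> update c e c' k = c k.
    by move=> kt; rewrite /update; case: eqP => // ke; rewrite -ke kt in et.
  have updw c' : \prod_(k <- t) coin_weight (update c e c' k) =
      \prod_(k <- t) coin_weight (c k).
    by rewrite !big_seq; apply: eq_bigr => k kt; rewrite upd.
  have AU : A t c = A (e :: t) (update c e true) `|` A (e :: t) (update c e false).
    apply/seteqP; split => x /=.
      move=> [h Fx]; have h' : forall k, k \in e :: t -> D x k = update c e (D x e) k.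
        move=> k; rewrite inE => /orP[/eqP ->|kt]; first by rewrite /update eqxx.
        by rewrite upd // h.
      by case: (D x e) h' => h'; [left|right].
    by move=> [[h Fx]|[h Fx]]; split => // k kt; rewrite h ?upd // inE kt orbT.
  rewrite AU measureU //; last first.
    apply/seteqP; split => // x [[h1 _] [h2 _]].
    have := h1 e; have := h2 e; rewrite inE eqxx /update eqxx.
    by move=> -> // /(_ isT).
  rewrite [X in (X + _)%E](IH _ _ tes') [X in (_ + X)%E](IH _ _ tes').
  rewrite -EFinD !big_cons !updw /resample; congr EFin.
  have ue c' : update c e c' e = c' by rewrite /update eqxx.
  by rewrite !ue /= /resample; ring.
rewrite (_ : [set x | F (D x)] = A [::] xpred0); last first.
  by apply/seteqP; split => x //= [].
have fr : depends_on (mem r) f by move=> b b' bb'; rewrite /f (Fr b b').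
by rewrite (claim r) // big_nil mul1r -(Ex_resamples p xpred0 fr).
Qed.

End FinitaryEvents.

Section Digits.
Variables (R : realType) (p : R).

(** The expanding map of the unit interval with two affine branches, on [0, p) and
    [p, 1): the first digit of [x] tells
    whether [x < p], and [zoom] erases it. *)
Definition zoom (x : R) : R := if x < p then x / p else (x - p) / (1 - p).

(** The digits are independent coins under the uniform law. *)
Definition digit (x : R) (n : nat) : bool := iter n zoom x < p.

Lemma measurable_zoom : measurable_fun setT zoom.
Proof.
apply: measurable_fun_ifT.
- by apply: measurable_fun_ltr => //; exact: measurable_cst.
- by apply: measurable_funM => //; exact: measurable_cst.
- apply: measurable_funM; last exact: measurable_cst.
  by apply: measurable_funB => //; exact: measurable_cst.
Qed.

Lemma measurable_digit n : measurable [set x | digit x n].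
Proof.
have mi : measurable_fun setT (iter n zoom).
  elim: n => [|n IH]; first exact: measurable_id.
  exact: (measurableT_comp measurable_zoom IH).
rewrite -[X in measurable X]setTI.
rewrite (_ : [set x | digit x n] = (fun x => digit x n) @^-1` [set true]); last first.
  by apply/seteqP; split => x.
by apply: measurable_fun_ltr => //; exact: measurable_cst.
Qed.

Hypotheses (p0 : 0 < p) (p1 : p < 1).

(** The points with prescribed first [n] digits form an interval, on which the
    [n]-th iterate of [zoom] is affine and onto [0, 1). *)
Lemma digit_interval (b : nat -> bool) n : exists l w : R,
  [/\ w = \prod_(k < n) coin_weight p (b k), 0 < w,
    forall x, ((0 <= x < 1) && all (fun k => digit x k == b k) (iota 0 n)) =
              (l <= x < l + w) &
    forall x, l <= x < l + w -> iter n zoom x = (x - l) / w].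
Proof.
have q0 : 0 < 1 - p by rewrite subr_gt0.
elim: n => [|n [l [w [wE w0 Hx Hi]]]].
  exists 0, 1; split => //; first by rewrite big_ord0.
  - by move=> x; rewrite add0r /= andbT.
  - by move=> x _; rewrite subr0 divr1.
have all_rcons x : all (fun k => digit x k == b k) (iota 0 n.+1) =
    all (fun k => digit x k == b k) (iota 0 n) && (digit x n == b n).
  by rewrite -addn1 iotaD all_cat /= andbT.
have dig x : l <= x < l + w -> digit x n = (x < l + p * w).
  by move=> lx; rewrite /digit Hi // ltr_pdivrMr // ltrBlDl.
have pw0 : 0 < p * w by rewrite mulr_gt0.
have pw1 : p * w < w by rewrite gtr_pMl.
have key x (c : bool) l' w' :
  (forall y, (l <= y < l + w) && (digit y n == c) = (l' <= y < l' + w')) ->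
  ((0 <= x < 1) && all (fun k => digit x k == b k) (iota 0 n.+1)) = (l' <= x < l' + w') \/ c <> b n.
  move=> h; have [cb|cb] := eqVneq c (b n); last by right; apply/eqP.
  by left; rewrite all_rcons andbA Hx -cb h.
case bn : (b n).
- have h y : (l <= y < l + w) && (digit y n == true) = (l <= y < l + p * w).
    have [ly|] := boolP (l <= y < l + w).
      by rewrite dig //= eqb_id; case/andP: ly => ->.
    by move=> nly; apply/esym/negbTE; move: nly; apply: contra => /andP[-> /=]; lra.
  exists l, (p * w); split => //.
  + by rewrite big_ord_recr /= -wE bn mulrC.
  + by move=> x; case: (key x true _ _ h) => //; rewrite bn.
  + move=> x lx /=; have ly : l <= x < l + w by case/andP: lx => -> /=; lra.
    rewrite Hi // /zoom ltr_pdivrMr // ltrBlDl.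
    case/andP: lx => _ ->; field; rewrite !gt_eqF //.
- have h y : (l <= y < l + w) && (digit y n == false) =
      (l + p * w <= y < l + p * w + (1 - p) * w).
    have -> : l + p * w + (1 - p) * w = l + w by ring.
    have [ly|] := boolP (l <= y < l + w).
      by rewrite dig //= eqbF_neg -leNgt; case/andP: ly => _ ->; rewrite andbT.
    by move=> nly; apply/esym/negbTE; move: nly; apply: contra => /andP[h1 ->]; rewrite andbT; lra.
  exists (l + p * w), ((1 - p) * w); split => //.
  + by rewrite big_ord_recr /= -wE bn mulrC.
  + by rewrite mulr_gt0.
  + by move=> x; case: (key x false _ _ h) => //; rewrite bn.
  + move=> x lx /=; have := h x; rewrite lx => /andP[ly _].
    rewrite Hi // /zoom ltr_pdivrMr // ltrBlDl.
    case/andP: lx => lx _; rewrite ltNge lx /=.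
    by field; rewrite !gt_eqF.
Qed.

End Digits.

Section UnitInterval.
Variable R : realType.

Let measurable_unit : measurable (`[0, 1[ : set (measurableTypeR R)).
Proof. exact: measurable_itv. Qed.

(** The uniform law on the unit interval. *)
Definition unit_law : set (measurableTypeR R) -> \bar R :=
  mrestr (@lebesgue_measure R) measurable_unit.

HB.instance Definition _ := Measure.on unit_law.

Let unit_law_setT : unit_law setT = 1%E.
Proof.
by rewrite /unit_law /mrestr setTI lebesgue_measure_itv /= lte_fin ltr01 oppr0 adde0.
Qed.

HB.instance Definition _ := Measure_isProbability.Build _ _ _ unit_law unit_law_setT.

Variables (p : R).
Hypotheses (p0 : 0 < p) (p1 : p < 1).

Lemma unit_law_digits (b : nat -> bool) n :
  unit_law [set x | forall k, k \in iota 0 n -> digit p x k = b k] =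
  (\prod_(k <- iota 0 n) coin_weight p (b k))%:E.
Proof.
have [l [w [wE w0 Hx _]]] := digit_interval p0 p1 b n.
rewrite /unit_law /mrestr (_ : _ `&` _ = [set` `[l, l + w[]); last first.
  apply/seteqP; split => x /=; rewrite !in_itv /= -Hx.
    by move=> [h ->] /=; apply/allP => k /h ->.
  by move=> /andP[-> /allP h]; split => // k /h /eqP.
rewrite lebesgue_measure_itv /= lte_fin ltrDl w0 -EFinB addrAC subrr add0r wE.
by rewrite -(big_mkord xpredT (fun k => coin_weight p (b k))) /index_iota subn0.
Qed.

Lemma unit_law_finitary (I : countType) (F : (I -> bool) -> bool) : finitary F ->
  unit_law [set x | F (fun e => digit p x (pickle e))] = (Pr p F)%:E.
Proof.
move=> [s Fs].
pose F' (b : nat -> bool) := F (fun e => b (pickle e)).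
have -> : Pr p F = Pr p F'.
  rewrite /Pr -(@Ex_relabel R I nat p pickle (fun b => (F b)%:R)) //.
  by apply: finitary_Pr; exists s.
pose n := (\max_(e <- s) pickle e).+1.
have md k : measurable ([set x | digit p x k] : set (measurableTypeR R)).
  exact: measurable_digit.
have F'n : depends_on (mem (iota 0 n)) F'.
  move=> b b' bb'; apply: Fs => e es; apply: bb'.
  rewrite -[mem _ _]/(pickle e \in iota 0 n) mem_iota add0n ltnS.
  exact: (@leq_bigmax_seq _ s xpredT (fun e => pickle e)).
exact: (@probability_finitary _ (measurableTypeR R) R nat (digit p) md unit_law p
  (iota 0 n) F' (iota_uniq _ _) F'n (fun c => unit_law_digits c n)).
Qed.

End UnitInterval.

(** * Measurability of coexistence *)

Section CountableQuantifiers.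
Context d (T : measurableType d) (U : countType).

Lemma measurable_exists (F : U -> set T) :
  (forall u, measurable (F u)) -> measurable [set x | exists u, F u x].
Proof.
move=> mF; rewrite (_ : [set x | _] = \bigcup_u F u).
  exact: countable_bigcupT_measurable.
by apply/seteqP; split => x /= => [[u Fu]|[u _ Fu]]; exists u.
Qed.

Lemma measurable_forall (F : U -> set T) :
  (forall u, measurable (F u)) -> measurable [set x | forall u, F u x].
Proof.
move=> mF; rewrite (_ : [set x | _] = ~` [set x | exists u, (~` F u) x]).
  by apply: measurableC; apply: measurable_exists => u; exact: measurableC.
apply/seteqP; split => x /=; first by move=> Fx [u]; apply.
by move=> h u; apply: contrapT => nF; apply: h; exists u.
Qed.

Lemma measurable_const_and (P : Prop) (A : set T) :
  measurable A -> measurable [set x | P /\ A x].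
Proof.
move=> mA; have [p|np] := pselect P.
  by rewrite (_ : [set x | _] = A) //; apply/seteqP; split => x //= [].
by rewrite (_ : [set x | _] = set0) //; apply/seteqP; split => x //= [].
Qed.

Lemma measurable_const_imply (P : Prop) (A : set T) :
  measurable A -> measurable [set x | P -> A x].
Proof.
move=> mA; have [p|np] := pselect P.
  rewrite (_ : [set x | _] = A) //; apply/seteqP; split => x /= h; last by [].
  exact: h.
by rewrite (_ : [set x | _] = setT) //; apply/seteqP; split => x //= _ p.
Qed.

End CountableQuantifiers.

Lemma infinite_set_seq (T : choiceType) (A : set T) :
  infinite_set A <-> forall s : seq T, exists z, z \notin s /\ A z.
Proof.
split.
  move=> Ainf s; apply: contrapT => h; apply: Ainf.
  apply: (sub_finite_set (B := [set` s])); last exact: finite_seq.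
  by move=> z Az; apply: contrapT => /negP zs; apply: h; exists z.
by move=> h /finite_seqP[s As]; have [z []] := h s; rewrite As /= => /negP.
Qed.

Section Law.
Variables (R : realType).

(** The weights 1 and 2 prescribed by the coins. *)
Definition weights_of (b : edge -> bool) : config R :=
  fun e => NngNum (ler0n R (b e).+1).

Lemma passage_time_weights_of b x y :
  passage_time (weights_of b) x y = (distance b x y)%:R.
Proof.
have pt q : path_time (weights_of b) x q = (time b x q)%:R.
  by rewrite /path_time /time natr_sum.
rewrite /passage_time; set S := (X in inf X).
have lbS : lbound S (distance b x y)%:R.
  by move=> _ [q [qx qy] <-]; rewrite pt ler_nat distance_le.
have [q [qx qy qt]] := geodesic b x y.
have Sd : S (distance b x y)%:R by exists q => //; rewrite pt qt.
apply/eqP; rewrite eq_le; apply/andP; split.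
  by apply: ge_inf => //; exists (distance b x y)%:R.
by apply: lb_le_inf => //; exists (distance b x y)%:R.
Qed.

Section Label.
Variables (w : config R) (k : nat) (x : 'I_k -> Z2) (z : Z2).

(** The point [x i] reaches [z] strictly before the other points. *)
Definition strictly_first (i : 'I_k) : bool := [forall j : 'I_k, (j != i) ==>
  (passage_time w (x i) z < passage_time w (x j) z)].

Lemma first_unique i j : strictly_first i -> strictly_first j -> i = j.
Proof.
move=> /forallP fi /forallP fj; apply/eqP; apply: contraT => ij.
have := fi j; rewrite eq_sym ij => /lt_trans h.
by have := fj i; rewrite ij => /h; rewrite ltxx.
Qed.

Lemma label_first (i : 'I_k) : label w x z = i.+1 <-> strictly_first i.
Proof.
have H (n : nat) : (\forall t \near +oo, label_at w x z t = n) -> label w x z = n.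
  by move=> h; apply: lim_near_cst => //; exact: discrete_hausdorff.
have first_label (j : 'I_k) : strictly_first j -> label w x z = j.+1.
  move=> fj; apply: H; exists (passage_time w (x j) z); split; first exact: num_real.
  move=> t /ltW jt; rewrite /label_at; case: pickP => [l /andP[_ fl]|].
    by rewrite (first_unique fl fj).
  by move=> /(_ j) /negbT; rewrite jt -/(strictly_first j) fj.
split; last exact: first_label.
move=> li; apply: contrapT => nfi.
have [j fj|nf] := pickP strictly_first.
  have := first_label _ fj; rewrite li => -[/val_inj ij].
  by apply: nfi; rewrite ij.
have : label w x z = 0%N.
  apply: H; exists 0; split; first exact: num_real.
  move=> t _; rewrite /label_at; case: pickP => // l /andP[_].
  by rewrite -/(strictly_first l) nf.
by rewrite li.
Qed.

End Label.

Lemma measurable_weight e : measurable_fun setT (weight e : config R -> R).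
Proof.
move=> _ B mB; rewrite setTI; apply: sub_sigma_algebra; exists e, B.
by split.
Qed.

Lemma measurable_path_time x q : measurable_fun setT (fun w : config R => path_time w x q).
Proof.
rewrite /path_time; apply: measurable_sum => e; exact: measurable_weight.
Qed.

(** An infimum is below [r] when a path is, which makes the passage times
    measurable since there are countably many paths. *)
Lemma passage_time_lt w x y (r : R) : passage_time w x y < r <->
  exists2 q, path neighbour x q /\ last x q = y & path_time w x q < r.
Proof.
set S := [set path_time w x q | q in [set q : seq Z2 | path neighbour x q /\ last x q = y]].
have lbS : lbound S 0.
  by move=> _ [q _ <-]; apply: sumr_ge0 => e _; rewrite /weight.
have S_inf : has_inf S.
  split; last by exists 0.
  by have [q [qx qy _]] := lattice_path x y; exists (path_time w x q), q.
split.
  rewrite /passage_time -/S -subr_gt0 => r0.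
  have [_ [q qq <-]] := inf_adherent r0 S_inf.
  by rewrite addrC subrK => h; exists q.
move=> [q qq qr]; apply: le_lt_trans qr.
by apply: ge_inf; [case: S_inf | exists q].
Qed.

Lemma measurable_passage_time_lt x y (r : R) :
  measurable [set w : config R | passage_time w x y < r].
Proof.
rewrite (_ : [set w | _] = [set w | exists q : seq Z2,
    (path neighbour x q /\ last x q = y) /\ path_time w x q < r]); last first.
  apply/seteqP; split => w /=; first by move=> /passage_time_lt[q qq qr]; exists q.
  by move=> [q [qq qr]]; apply/passage_time_lt; exists q.
apply: measurable_exists => q; apply: measurable_const_and.
rewrite -[X in measurable X]setTI.
exact: (measurable_fun_ltr (measurable_path_time x q) (measurable_cst r) measurableT
  (Y := [set true])).
Qed.

Lemma measurable_first k (x : 'I_k -> Z2) z i :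
  measurable [set w : config R | strictly_first w x z i].
Proof.
have lt_rat w x' y' : passage_time w x' z < passage_time w y' z <->
    exists r : rat, passage_time w x' z < ratr r /\ ~ (passage_time w y' z < ratr r :> R).
  split.
    move=> /rat_in_itvoo [r]; rewrite in_itv /= => /andP[h1 h2].
    by exists r; split => //; apply/negP; rewrite -leNgt ltW.
  by move=> [r [h1 /negP]]; rewrite -leNgt; exact: lt_le_trans.
rewrite (_ : [set w | _] = [set w | forall j : 'I_k, j != i ->
    exists r : rat, passage_time w (x i) z < ratr r /\
                    ~ (passage_time w (x j) z < ratr r :> R)]); last first.
  apply/seteqP; split => w /=.
    by move=> /forallP h j ji; have := h j; rewrite ji => /lt_rat.
  by move=> h; apply/forallP => j; apply/implyP => ji; apply/lt_rat; exact: h.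
apply: measurable_forall => j; apply: measurable_const_imply.
apply: measurable_exists => r; apply: measurableI.
  exact: measurable_passage_time_lt.
by apply: measurableC; exact: measurable_passage_time_lt.
Qed.

(** A set of sites is infinite when it is contained in no finite list. *)
Lemma coexistence_first k (x : 'I_k -> Z2) (w : config R) : coexistence x w <->
  forall (i : 'I_k) (s : seq Z2), exists z, z \notin s /\ strictly_first w x z i.
Proof.
split=> h i.
  by move=> s; have /infinite_set_seq/(_ s)[z [zs /label_first zi]] := h i; exists z.
by apply/infinite_set_seq => s; have [z [zs /label_first zi]] := h i s; exists z.
Qed.

Lemma measurable_coexistence k (x : 'I_k -> Z2) : measurable (coexistence x : set (config R)).
Proof.
rewrite (_ : coexistence x = [set w : config R | forall (i : 'I_k) (s : seq Z2),
    exists z, z \notin s /\ strictly_first w x z i]); last first.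
  by apply/seteqP; split => w /coexistence_first.
apply: measurable_forall => i; apply: measurable_forall => s.
apply: measurable_exists => z; apply: measurable_const_and.
exact: measurable_first.
Qed.

End Law.

(** * The law of the weights and coexistence *)

Section RandomEnvironment.
Variables (R : realType) (p : R).

(** One coin for each edge. *)
Definition coins_of (u : R) : edge -> bool := fun e => digit p u (pickle e).

(** The random weights. *)
Definition environment (u : measurableTypeR R) : config R := weights_of R (coins_of u).

Lemma measurable_coins (F : (edge -> bool) -> bool) : finitary F ->
  measurable ([set u | F (coins_of u)] : set (measurableTypeR R)).
Proof.
apply: measurable_finitary => e.
exact: (measurable_digit p (pickle e)).
Qed.

Lemma environment_preimage e (B : set R) :
  environment @^-1` (weight e @^-1` B) =
  [set u | (fun b : edge -> bool => `[< B (b e).+1%:R >]) (coins_of u)].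
Proof. by apply/seteqP; split => u /= /asboolP. Qed.

Lemma finitary_weight_event e (B : set R) :
  finitary (fun b : edge -> bool => `[< B (b e).+1%:R >]).
Proof. exact: (finitary_comp (fun c : bool => `[< B c.+1%:R >]) (finitary_coord e)). Qed.

Lemma measurable_environment : measurable_fun setT environment.
Proof.
apply: (@measurability _ _ _ (config R) setT environment (@cylinders R) erefl).
move=> _ [_ [e [B [mB ->]]] <-]; rewrite setTI environment_preimage.
exact: measurable_coins (finitary_weight_event e B).
Qed.

HB.instance Definition _ :=
  isMeasurableFun.Build _ _ _ _ environment measurable_environment.

(** The i.i.d. law with weights 1 and 2, the latter with probability [p]. *)
Definition two_point_law : probability (config R) R :=
  distribution (@unit_law R) environment.

Hypotheses (p0 : 0 < p) (p1 : p < 1).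

Lemma two_point_law_preimage (A : set (config R)) (F : (edge -> bool) -> bool) :
  finitary F -> (forall b, A (weights_of R b) <-> F b) ->
  two_point_law A = (Pr p F)%:E.
Proof.
move=> fF AF; rewrite -(unit_law_finitary p0 p1 fF) /two_point_law /distribution /pushforward.
by congr (unit_law _); apply/seteqP; split => u /AF.
Qed.

Lemma marginal_two_point e (B : set R) : marginal two_point_law e B =
  (Pr p (fun b : edge -> bool => `[< B (b e).+1%:R >]))%:E.
Proof.
apply: two_point_law_preimage; first exact: finitary_weight_event.
by move=> b; split => /asboolP.
Qed.

Lemma Pr_coord e (B : set R) : Pr p (fun b : edge -> bool => `[< B (b e).+1%:R >]) =
  p * (`[< B 2%:R >])%:R + (1 - p) * (`[< B 1%:R >])%:R.
Proof. exact: (Ex_coord p e (fun c : bool => (`[< B c.+1%:R >])%:R)). Qed.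

Lemma iid_two_point : iid two_point_law.
Proof.
split; last first.
  by move=> e e' B mB; rewrite !marginal_two_point !Pr_coord.
move=> s B us mB.
pose F e (b : edge -> bool) : bool := `[< B e (b e).+1%:R >].
have fF e : finitary (F e) by exact: finitary_weight_event.
have fall t : finitary (fun b => all (F^~ b) t).
  elim: t => [|e t IH]; first exact: finitary_cst.
  exact: (finitary_comp2 andb (fF e) IH).
rewrite (two_point_law_preimage (fall s)); last first.
  move=> b; split; first by move=> h; apply/allP => e /h /asboolP.
  by move=> /allP h e /h /asboolP.
have -> : Pr p (fun b => all (F^~ b) s) = \prod_(e <- s) Pr p (F e).
  elim: s us => [|e s IH] us.
    by rewrite big_nil /Pr Ex_cst.
  move: us => /= /andP[es us]; rewrite big_cons -IH // /Pr.
  rewrite -(@Ex_indep R _ p (pred1 e) (mem s)).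
  - by congr Ex; apply/funext => b; case: (F e b); rewrite /= ?mul1r ?mul0r.
  - exact: finitary_Pr.
  - exact: (finitary_Pr R (fall s)).
  - by move=> b b' bb'; rewrite /F bb' //= eqxx.
  - move=> b b' bb'; congr (nat_of_bool _)%:R.
    by apply: eq_in_all => k ks; rewrite /F bb'.
  - by move=> k /= /eqP ->.
elim: s {us fall} => [|e s IH]; first by rewrite !big_nil.
by rewrite !big_cons EFinM IH marginal_two_point.
Qed.

Lemma nontrivial_two_point : nontrivial two_point_law.
Proof.
move=> e [a /(_ [set 1%R] (measurable_set1 _))].
rewrite marginal_two_point Pr_coord diracE.
have -> : `[< [set 1%R] (2%:R : R) >] = false.
  by apply/negbTE/asboolP => /= /eqP; rewrite (eqr_nat R 2 1).
have -> : `[< [set 1%R] (1%:R : R) >] = true by apply/asboolP.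
rewrite mulr0 add0r mulr1 => -[].
by case: (a \in _) => /=; move: p0 p1 => *; lra.
Qed.

(** A point which is likely to be ahead at infinitely many sites is ahead at
    infinitely many sites with high probability, by Fatou's lemma for sets. *)
Lemma often_ahead (x : Z2) (s : seq Z2) (z : nat -> Z2) (eta : R) :
  (forall n0, exists n, (n0 <= n)%N /\ 1 - eta <= Pr p (wins x s (z n))) ->
  let A := [set u : measurableTypeR R |
             forall n0, exists n, (n0 <= n)%N /\ wins x s (z n) (coins_of u)] in
  measurable A /\ (unit_law (~` A) <= eta%:E)%E.
Proof.
move=> ahead A.
pose G n : set (measurableTypeR R) := [set u | wins x s (z n) (coins_of u)].
have mG n : measurable (G n) by apply: measurable_coins; exact: finitary_wins.
pose E n0 : set (measurableTypeR R) := \bigcap_(n in [set n | (n0 <= n)%N]) ~` G n.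
have mE n0 : measurable (E n0).
  by apply: bigcap_measurable => [|n _]; [exists n0 => /= | exact: measurableC].
have AE : ~` A = \bigcup_n0 E n0.
  apply/seteqP; split => u /=.
    move=> /existsNP[n0 h]; exists n0 => // n /= n0n gn; apply: h; exists n.
    by split.
  by move=> [n0 _ h] /(_ n0)[n [n0n gn]]; exact: (h n n0n).
have mA : measurable A.
  by rewrite -[A]setCK AE; apply: measurableC; exact: bigcup_measurable.
split => //; rewrite AE.
have Ele n0 : (unit_law (E n0) <= eta%:E)%E.
  have [n [n0n h]] := ahead n0.
  apply: (@le_trans _ _ (unit_law (~` G n))).
    apply: le_measure; rewrite ?inE //; first exact: measurableC.
    by move=> u /(_ n n0n).
  have PG : unit_law (G n) = (Pr p (wins x s (z n)))%:E.
    exact: (unit_law_finitary p0 p1 (finitary_wins x s (z n))).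
  by rewrite probability_setC // [X in (1 - X)%E]PG -EFinB lee_fin; lra.
have Emono : nondecreasing_seq E.
  by move=> m n mn; apply/subsetPset => u Eu k /= nk; apply: Eu => /=; exact: leq_trans nk.
have cvgE := @nondecreasing_cvg_mu _ _ R (@unit_law R) E mE
  (bigcup_measurable (fun n _ => mE n)) Emono.
by apply: (cvge_to_le cvgE); apply: nearW.
Qed.

End RandomEnvironment.

Theorem corollary1p7 (R : realType) :
  exists mu : probability (config R) R,
    iid mu /\ nontrivial mu /\
    exists x : 'I_8 -> Z2, (0 < mu (coexistence x))%E.
Proof.
pose p : R := 1 / 10%:R ^+ 3.
have p0 : 0 < p by rewrite /p; lra.
have p1 : p < 1 by rewrite /p; lra.
exists (two_point_law p); split; first exact: iid_two_point.
split; first exact: nontrivial_two_point.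
have [s [s8 us sP]] := @advantage R (1 / 16%:R) ltac:(lra).
pose x (i : 'I_8) : Z2 := nth 0 s i.
have xs i : x i \in s by apply: mem_nth; rewrite s8.
exists x.
pose ahead (i : 'I_8) := [set u : measurableTypeR R |
  forall t : seq Z2, exists z, z \notin t /\ wins (x i) [seq y <- s | y != x i] z (coins_of p u)].
have bad i : exists B : set (measurableTypeR R),
    [/\ measurable B, (unit_law B <= (1 / 16%:R)%:E)%E & ~` ahead i `<=` B].
  have [z zI zP] := sP _ (xs i).
  have [mA PA] := often_ahead p0 p1 zP.
  eexists; split; [exact: measurableC mA | exact: PA |].
  apply: subsetC => u /= hu t.
  (* an index beyond those of all the sites of [t] *)
  have [n [n0 wn]] := hu (\max_(v <- t) (if pselect (exists m, z m = v) is left h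
     then projT1 (cid h) else 0%N)).+1.
  exists (z n); split => //; apply/negP => zt.
  have := @leq_bigmax_seq _ t xpredT (fun v => if pselect (exists m, z m = v) is left h
     then projT1 (cid h) else 0%N) _ zt isT.
  case: pselect => [h|[]]; last by exists n.
  by case: (cid h) => m /= /zI -> ; rewrite leqNgt n0.
have coex u : (forall i, ahead i u) -> coexistence x (environment p u).
  move=> hu; apply/coexistence_first => i t; have [z [zt /allP wz]] := hu i t.
  exists z; split => //; apply/forallP => j; apply/implyP => ji.
  rewrite !passage_time_weights_of ltr_nat; apply: wz.
  rewrite mem_filter xs andbT; apply: contra ji => /eqP.
  by rewrite /x => /eqP; rewrite nth_uniq ?s8.
have [B hB] := choice bad.
have mC : measurable (environment p @^-1` coexistence x).
  by rewrite -[X in measurable X]setTI; apply: measurable_environment => //;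
    exact: measurable_coexistence.
pose BU := \big[setU/set0]_(i < 8) B (inord i).
have mBU : measurable BU by apply: bigsetU_measurable => i _; have [] := hB (inord i).
have PBU : (unit_law BU <= (1 / 2%:R)%:E)%E.
  apply: le_trans (Boole_inequality (@unit_law R) (A := fun i => B (inord i)) _) _.
    by move=> i _; have [] := hB (inord i).
  apply: (@le_trans _ _ (\sum_(i < 8) (1 / 16%:R)%:E)%E).
    by apply: lee_sum => i _; have [] := hB (inord i).
  rewrite sumEFin lee_fin sumr_const card_ord -mulr_natr; lra.
rewrite /two_point_law /distribution /pushforward.
have : (unit_law (~` BU) <= unit_law (environment p @^-1` coexistence x))%E.
  apply: le_measure; rewrite ?inE //; first exact: measurableC.
  move=> u /= nBU; apply: coex => i; apply: contrapT => na; apply: nBU.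
  have [_ _ /(_ u na) Bu] := hB i.
  rewrite /BU -(bigcup_mkord 8 (fun i => B (inord i))); exists i => /=; first exact: ltn_ord.
  by rewrite inord_val.
apply: lt_le_trans; rewrite probability_setC //.
by rewrite sube_gt0; apply: le_lt_trans PBU _; rewrite lte_fin; lra.
Qed.
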